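(* Let $m$ be a non-negative integer, let $z$ be a real number with $|z|\ge 1$, and let $z_1,z_2,z_3\in\mathbb{C}$ be the distinct roots of $x(1-x)^2-z=0$. Then $$\sum_{k=0}^\infty \frac{H_{3k+1}-H_k}{(3k+1)\binom{3k}{k}}\,\frac{\binom{k}{m}}{z^{k+1}} = (-1)^m\sum_{l=1}^3\sum_{j=0}^m a_j(z_l)\,C_j(z_l),$$ where, for $0\le r\le m$ and $\lambda\in\{z_1,z_2,z_3\}$, $$a_r(\lambda)=\frac{1}{(m-r)!}\left.\frac{d^{m-r}}{dx^{m-r}}\,\frac{x^m(1-x)^{2m}(x-\lambda)^{m+1}}{\left(x(1-x)^2-z\right)^{m+1}}\right|_{x=\lambda},$$ $$C_0(\lambda)=\mathrm{Li}_2\left(\frac1\lambda\right),$$ and, for $r$ a positive integer and $\lambda\notin[0,1]$, $$C_r(\lambda)=\frac{(-1)^r}{r}\sum_{p=1}^{r-1}\frac{1}{p\,\lambda^{r-p}}\left(\frac{1}{(\lambda-1)^p}-\frac{1}{\lambda^p}\right)-\frac{(-1)^r}{r\lambda^r}\ln\left(\frac{\lambda-1}{\lambda}\right).$$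
   Context: $H_n=\sum_{k=1}^n \frac1k$ with $H_0=0$. $\mathrm{Li}_2$ is the dilogarithm, $\mathrm{Li}_2(w)=\sum_{k\ge1} w^k/k^2$ for $|w|\le1$, extended to $\mathbb{C}\setminus(1,\infty)$ by its principal branch (analytic on $\mathbb{C}\setminus[1,\infty)$). $\ln$ of a complex number is the principal branch. In $a_r(\lambda)$ the function being differentiated is understood after cancelling the factor $(x-\lambda)^{m+1}$ (removable singularity at $x=\lambda$). Empty sums are $0$, and $\binom{k}{m}=0$ for $k<m$. *)

(* Defs.v *)
(* Stdlib reals with Coquelicot; mathcomp is used only for [binomial]. *)
From Stdlib Require Import Reals Factorial Lra.
From mathcomp Require binomial.
From Coquelicot Require Import Coquelicot.

Open Scope C_scope.

(* Stdlib's [Binomial.C n k] does not vanish for [n < k]; this one does. *)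
Notation binom := mathcomp.boot.binomial.binomial.

Definition harmonic (n : nat) : R := sum_n_m (fun k => (/ INR k)%R) 1 n.

(* Principal argument, in (-PI, PI] for z <> 0. *)
Definition Carg (z : C) : R :=
  if Rlt_dec (Im z) 0 then (- acos (Re z / Cmod z))%R
  else acos (Re z / Cmod z).

Definition Cln (z : C) : C := (ln (Cmod z), Carg z).

Lemma Carg_spec (z : C) : z <> 0 ->
  (- PI < Carg z <= PI)%R /\
  z = ((Cmod z * cos (Carg z))%R, (Cmod z * sin (Carg z))%R).
Proof.
intros Hz.
assert (Hm : (0 < Cmod z)%R) by now apply Cmod_gt_0.
destruct z as [x y]; unfold Carg, Re, Im; cbn [fst snd].
set (r := Cmod (x, y)) in *.
assert (Hr : (r * r = x * x + y * y)%R).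
{ unfold r, Cmod; cbn [fst snd]. rewrite sqrt_sqrt; [ring | nra]. }
set (t := (x / r)%R).
assert (Hx : (x = r * t)%R) by (unfold t; field; lra).
assert (Hy : (y * y = r * r * (1 - t * t))%R) by (rewrite Hx in Hr; nra).
assert (Ht : (-1 <= t <= 1)%R).
{ assert (0 <= 1 - t * t)%R; [ | nra].
  apply Rmult_le_reg_l with (r * r)%R; nra. }
assert (Hs : (r * sqrt (1 - t²) = Rabs y)%R).
{ rewrite <- (sqrt_Rsqr r) by lra.
  rewrite <- sqrt_mult_alt by apply Rle_0_sqr.
  rewrite <- sqrt_Rsqr_abs. f_equal. unfold Rsqr. lra. }
pose proof (acos_bound t) as Hb.
destruct (Rlt_dec y 0) as [Hlt | Hge].
- assert (Hne : (acos t <> PI)%R).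
  { intros E. apply (f_equal cos) in E. rewrite cos_acos, cos_PI in E by lra.
    rewrite E in Hy. nra. }
  split; [lra | ].
  rewrite cos_neg, sin_neg, cos_acos, sin_acos by lra.
  rewrite <- Hx. f_equal.
  rewrite Ropp_mult_distr_r_reverse, Hs, Rabs_left; lra.
- split; [pose proof PI_RGT_0; lra | ].
  rewrite cos_acos, sin_acos by lra.
  rewrite <- Hx, Hs, Rabs_right by lra. reflexivity.
Qed.

Definition analytic_at (f : C -> C) (w0 : C) : Prop :=
  exists (a : nat -> C) (eps : posreal), forall w : C,
    (Cmod (w - w0) < eps)%R ->
    is_pseries (K := C_AbsRing) (V := C_NormedModule) a (w - w0) (f w).

(* Determines [L] uniquely on the complement of (1, +oo), and says nothing
   about its values on (1, +oo). *)
Definition is_dilogarithm (L : C -> C) : Prop :=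
  (forall w : C, (Cmod w <= 1)%R ->
     is_series (K := C_AbsRing) (V := C_NormedModule)
       (fun k => w ^ S k / RtoC (INR (S k)) ^ 2) (L w)) /\
  (forall w : C, ~ (Im w = 0%R /\ (1 <= Re w)%R) -> analytic_at L w).

(* [C_derive] is the total derivative operator: it is the complex derivative
   only where that derivative exists. *)
Fixpoint C_derive_n (f : C -> C) (n : nat) : C -> C :=
  match n with
  | O => f
  | S n' => C_derive (C_derive_n f n')
  end.

(* [f] with its (removable) singularity at [x0] filled in by the limit. *)
Definition remove_singularity (f : C -> C) (x0 : C) : C -> C :=
  fun x => if Ceq_dec x x0 then C_lim f x0 else f x.

Definition a_coef (m : nat) (z : R) (r : nat) (lam : C) : C :=
  1 / RtoC (INR (fact (m - r))) *
  C_derive_n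
    (remove_singularity
       (fun x => x ^ m * (1 - x) ^ (2 * m) * (x - lam) ^ S m
                 / (x * (1 - x) ^ 2 - RtoC z) ^ S m) lam)
    (m - r) lam.

Definition C_coef (Li2 : C -> C) (r : nat) (lam : C) : C :=
  match r with
  | O => Li2 (1 / lam)
  | S _ =>
      (-1) ^ r / RtoC (INR r) *
      sum_n_m (G := C_AbelianMonoid)
        (fun p => 1 / (RtoC (INR p) * lam ^ (r - p)) *
                  (1 / (lam - 1) ^ p - 1 / lam ^ p))
        1 (r - 1)
      - (-1) ^ r / (RtoC (INR r) * lam ^ r) * Cln ((lam - 1) / lam)
  end.

Definition lhs_term (m : nat) (z : R) (k : nat) : R :=
  ((harmonic (3 * k + 1) - harmonic k)
   / (INR (3 * k + 1) * INR (binom (3 * k) k))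
   * (INR (binom k m) / z ^ (k + 1)))%R.

(* Main.v *)
Require Import Defs.
From Stdlib Require Import Reals Lra Lia Psatz.
From mathcomp Require ssrnat binomial.
From Coquelicot Require Import Coquelicot.

(** Write [u = x (1 - x)^2].  Differentiating the Beta integral with respect to
an exponent identifies the [k]-th summand with
[- binom(k,m) / z^(k+1) * int_0^1 ln x * u^k dx].  Since [0 <= u <= 1/4] on
[[0,1]] and [|z| >= 1], summing under the integral turns the series into
[(-1)^m int_0^1 ln x * u^m / (u - z)^(m+1) dx].  The [a_r(z_l)] are the
partial fraction coefficients of [u^m / (u - z)^(m+1)], and
[C_r(lam) = int_0^1 ln x / (x - lam)^(r+1) dx].

No integral is needed: if [P' = Q] and [(x Q)' = f], then two integrations by
parts give [int_0^1 ln x * f(x) dx = P 0 - P 1], and [|P 0 - P 1| <= sup |f|] by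
the mean value theorem.  For a simple pole this asks for
[P x = - Li2 (x / lam)]; the required differential equation holds near [0] by
the power series and extends to [[0,1]] by the identity theorem for
real-analytic functions. *)

(** * Complex derivatives and Taylor coefficients *)

Open Scope C_scope.

(** The logarithm is singular at 0, so [f] is written as [(x Q)'] with a factor [x] in front: that
    factor removes the boundary term at 0, [ln 1 = 0] removes the one at 1, and
    [- int Q = P 0 - P 1] is left. What is used of the integral is linearity, the bound, and one
    explicit pair [P], [Q] per integrand.

    Two obstacles shape the rest. First, [a_coef] is built from iterated total derivatives of a
    function patched at its pole; hence partial fractions are first obtained with anonymous
    coefficients, which a Taylor formula with smooth remainder then identifies. Second, a root [lam]
    may lie inside the unit disk, and then the series of [Li2] does not reach the end of the segment
    from 0 to [1 / lam]. Beyond the disk [is_dilogarithm] gives only local power series, so the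
    differential equation is continued along the segment in a real parameter.

    The condition [|z| >= 1] has a second use: [z] is not a value of [u] on [[0,1]], so no root lies
    on that segment, where poles and branch cuts would be met. *)

Ltac eq_at T := match goal with |- @eq _ ?a ?b => change (@eq T a b) end.
Ltac cring := eq_at C; ring.

Notation csum := (sum_n (G := C_AbelianMonoid)).

Lemma csum_O (f : nat -> C) : csum f 0 = f 0%nat.
Proof. exact (sum_O (G := C_AbelianMonoid) f). Qed.

Lemma csum_S (f : nat -> C) (n : nat) : csum f (S n) = csum f n + f (S n).
Proof. exact (sum_Sn (G := C_AbelianMonoid) f n). Qed.

Lemma csum_ext (f g : nat -> C) (n : nat) :
  (forall k, (k <= n)%nat -> f k = g k) -> csum f n = csum g n.
Proof. exact (sum_n_ext_loc (G := C_AbelianMonoid) f g n). Qed.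

Lemma csum_plus (f g : nat -> C) (n : nat) :
  csum (fun k => f k + g k) n = csum f n + csum g n.
Proof. exact (sum_n_plus (G := C_AbelianMonoid) f g n). Qed.

Lemma csum_mult_l (a : C) (f : nat -> C) (n : nat) :
  csum (fun k => a * f k) n = a * csum f n.
Proof.
induction n as [|n IH]; [now rewrite !csum_O|].
rewrite !csum_S, IH; cring.
Qed.

Lemma csum_shift (f : nat -> C) (n : nat) :
  csum f (S n) = f 0%nat + csum (fun k => f (S k)) n.
Proof.
induction n as [|n IH]; [now rewrite csum_S, !csum_O|].
rewrite csum_S, IH, csum_S; cring.
Qed.

(** [C] is taken as a module over itself, with disks for [Cmod] as neighbourhoods, because the
    generic product rule has that form; [is_Cderive_unique] is the bridge to [C_derive]. *)
Definition is_Cderive (f : C -> C) (x l : C) : Prop :=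
  is_derive (K := C_AbsRing) (V := AbsRing_NormedModule C_AbsRing) f x l.

Notation near x P := (locally (T := AbsRing_UniformSpace C_AbsRing) x P).

Lemma near_C (x : C) (P : C -> Prop) :
  near x P <-> exists eps : posreal, forall y, (Cmod (y - x) < eps)%R -> P y.
Proof. split; intros [e He]; exists e; exact He. Qed.

Lemma is_Cderive_unique (f : C -> C) (x l : C) : is_Cderive f x l -> C_derive f x = l.
Proof.
intros [Hl Hd]; apply is_C_derive_unique; split; [|exact Hd].
split; [apply Hl | apply Hl | exact (linear_norm _ Hl)].
Qed.

Lemma is_Cderive_ext (f g : C -> C) (x l : C) :
  near x (fun y => f y = g y) -> is_Cderive f x l -> is_Cderive g x l.
Proof.
exact (is_derive_ext_loc (K := C_AbsRing) (V := AbsRing_NormedModule C_AbsRing) f g x l).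
Qed.

Lemma is_Cderive_const (a x : C) : is_Cderive (fun _ => a) x 0.
Proof. apply (is_derive_const (K := C_AbsRing) (V := AbsRing_NormedModule C_AbsRing)). Qed.

Lemma is_Cderive_id (x : C) : is_Cderive (fun y => y) x 1.
Proof. apply (is_derive_id (K := C_AbsRing)). Qed.

Lemma is_Cderive_plus (f g : C -> C) (x df dg : C) :
  is_Cderive f x df -> is_Cderive g x dg -> is_Cderive (fun y => f y + g y) x (df + dg).
Proof. apply (is_derive_plus (K := C_AbsRing) (V := AbsRing_NormedModule C_AbsRing)). Qed.

Lemma is_Cderive_mult (f g : C -> C) (x df dg : C) :
  is_Cderive f x df -> is_Cderive g x dg ->
  is_Cderive (fun y => f y * g y) x (df * g x + f x * dg).
Proof.
intros Hf Hg; apply (is_derive_mult (K := C_AbsRing) f g x df dg Hf Hg).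
exact Cmult_comm.
Qed.

Lemma is_Cderive_scal (a : C) (f : C -> C) (x df : C) :
  is_Cderive f x df -> is_Cderive (fun y => a * f y) x (a * df).
Proof.
intros Hf; replace (a * df) with (0 * f x + a * df) by cring.
apply (is_Cderive_mult (fun _ => a)); [apply is_Cderive_const | exact Hf].
Qed.

Lemma is_Cderive_pow (mu x : C) (n : nat) :
  is_Cderive (fun y => (y - mu) ^ S n) x (RtoC (INR (S n)) * (x - mu) ^ n).
Proof.
assert (H1 : is_Cderive (fun y => y - mu) x 1).
{ replace (RtoC 1) with (1 + 0) by cring.
  apply (is_Cderive_plus (fun y => y) (fun _ => - mu));
    [apply is_Cderive_id | apply is_Cderive_const]. }
induction n as [|n IH].
- replace (RtoC (INR 1) * (x - mu) ^ 0) with (RtoC 1) by (simpl; cring).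
  apply is_Cderive_ext with (2 := H1); apply filter_forall; intros y; simpl; cring.
- replace (RtoC (INR (S (S n))) * (x - mu) ^ S n) with
    (1 * (x - mu) ^ S n + (x - mu) * (RtoC (INR (S n)) * (x - mu) ^ n)).
  + apply (is_Cderive_mult (fun y => y - mu)); assumption.
  + rewrite (S_INR (S n)), RtoC_plus; simpl Cpow; cring.
Qed.

Lemma is_Cderive_inv (mu x : C) : x <> mu ->
  is_Cderive (fun y => / (y - mu)) x (- (/ (x - mu) * / (x - mu))).
Proof.
intros Hx.
assert (Hd : x - mu <> 0) by now apply Cminus_eq_contra.
split; [apply is_linear_scal_l|].
intros x' Hx'.
apply (is_filter_lim_locally_unique (K := C_AbsRing)
  (V := AbsRing_NormedModule C_AbsRing)) in Hx'; subst x'.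
intros eps.
set (r := Cmod (x - mu)).
assert (Hr : (0 < r)%R) by now apply Cmod_gt_0.
(* The error divided by [y - x] is [(y - x) / ((x - mu)^2 (y - mu))]. The radius [r / 2] keeps
   [|y - mu| > r / 2], and [eps r^3 / 2] then makes the modulus at most [eps]. *)
assert (Hdel : (0 < Rmin (r / 2) (eps * r ^ 3 / 2))%R).
{ apply Rmin_pos; [lra|].
  pose proof (cond_pos eps); pose proof (pow_lt r 3 Hr); nra. }
apply near_C; exists (mkposreal _ Hdel); simpl pos; intros y Hy.
assert (Hy1 : (Cmod (y - x) < r / 2)%R)
  by (eapply Rlt_le_trans; [exact Hy | apply Rmin_l]).
assert (Hy2 : (Cmod (y - x) < eps * r ^ 3 / 2)%R)
  by (eapply Rlt_le_trans; [exact Hy | apply Rmin_r]).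
assert (Hym : (r / 2 < Cmod (y - mu))%R).
{ assert (r <= Cmod (y - mu) + Cmod (y - x))%R; [|lra].
  rewrite <- (Cmod_opp (y - x)); unfold r.
  replace (x - mu) with ((y - mu) + - (y - x)) by cring.
  apply Cmod_triangle. }
assert (Hy0 : y - mu <> 0) by (apply Cmod_gt_0; lra).
change (Cmod ((/ (y - mu) - / (x - mu)) - (y - x) * (- (/ (x - mu) * / (x - mu))))
  <= eps * Cmod (y - x))%R.
replace ((/ (y - mu) - / (x - mu)) - (y - x) * (- (/ (x - mu) * / (x - mu))))
  with ((y - x) * ((y - x) * / ((x - mu) * ((x - mu) * (y - mu))))).
2:{ field; split; assumption. }
rewrite (Cmod_mult (y - x)), Rmult_comm; apply Rmult_le_compat_r; [apply Cmod_ge_0|].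
rewrite Cmod_mult, Cmod_inv by (repeat apply Cmult_neq_0; assumption).
rewrite !Cmod_mult; fold r.
apply Rle_div_l; [repeat apply Rmult_lt_0_compat; lra|].
pose proof (cond_pos eps).
apply Rle_trans with (eps * (r * (r * (r / 2))))%R; [nra|].
apply Rmult_le_compat_l; [lra|].
apply Rmult_le_compat_l; [lra|].
apply Rmult_le_compat_l; lra.
Qed.

(** The derivatives are existential witnesses, since the total operator [C_derive] carries no
    information on differentiability; closure under sums and products amounts to exhibiting the next
    derivative. *)
Fixpoint csmooth (n : nat) (f : C -> C) (x0 : C) : Prop :=
  match n with
  | O => True
  | S n' => exists f' : C -> C,
      near x0 (fun x => is_Cderive f x (f' x)) /\ csmooth n' f' x0
  end.

Lemma csmooth_ext (n : nat) (f g : C -> C) (x0 : C) :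
  near x0 (fun x => f x = g x) -> csmooth n f x0 -> csmooth n g x0.
Proof.
destruct n as [|n]; [trivial|].
intros E [f' [Hd Hs]]; exists f'; split; [|exact Hs].
generalize (filter_and _ _ Hd
  (locally_locally (T := AbsRing_UniformSpace C_AbsRing) _ _ E)).
apply filter_imp; intros x [Hx Hx']; revert Hx; now apply is_Cderive_ext.
Qed.

Lemma csmooth_pred (n : nat) (f : C -> C) (x0 : C) :
  csmooth (S n) f x0 -> csmooth n f x0.
Proof.
revert f; induction n as [|n IH]; intros f; [intros _; exact I|].
intros [f' [Hd Hs]]; exists f'; split; [exact Hd | now apply IH].
Qed.

Lemma csmooth_const (n : nat) (a x0 : C) : csmooth n (fun _ => a) x0.
Proof.
revert a; induction n as [|n IH]; intros a; [exact I|].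
exists (fun _ => RtoC 0); split; [|apply IH].
apply filter_forall; intros x; apply is_Cderive_const.
Qed.

Lemma csmooth_plus (n : nat) (f g : C -> C) (x0 : C) :
  csmooth n f x0 -> csmooth n g x0 -> csmooth n (fun x => f x + g x) x0.
Proof.
revert f g; induction n as [|n IH]; intros f g; [intros; exact I|].
intros [f' [Hf Hf']] [g' [Hg Hg']].
exists (fun x => f' x + g' x); split; [|now apply IH].
generalize (filter_and _ _ Hf Hg); apply filter_imp.
intros x [H1 H2]; now apply is_Cderive_plus.
Qed.

Lemma csmooth_mult (n : nat) (f g : C -> C) (x0 : C) :
  csmooth n f x0 -> csmooth n g x0 -> csmooth n (fun x => f x * g x) x0.
Proof.
revert f g; induction n as [|n IH]; intros f g; [intros; exact I|].
intros Hf0 Hg0.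
pose proof (csmooth_pred _ _ _ Hf0); pose proof (csmooth_pred _ _ _ Hg0).
destruct Hf0 as [f' [Hf Hf']]; destruct Hg0 as [g' [Hg Hg']].
exists (fun x => f' x * g x + f x * g' x); split.
- generalize (filter_and _ _ Hf Hg); apply filter_imp.
  intros x [H1 H2]; now apply is_Cderive_mult.
- apply csmooth_plus; now apply IH.
Qed.

Lemma csmooth_scal (n : nat) (a : C) (f : C -> C) (x0 : C) :
  csmooth n f x0 -> csmooth n (fun x => a * f x) x0.
Proof.
intros Hf; apply (csmooth_mult n (fun _ => a)); [apply csmooth_const | exact Hf].
Qed.

Lemma csmooth_sub (n : nat) (mu x0 : C) : csmooth n (fun x => x - mu) x0.
Proof.
destruct n as [|n]; [exact I|].
exists (fun _ => 1 + 0); split; [|apply csmooth_const].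
apply filter_forall; intros x.
apply (is_Cderive_plus (fun y => y) (fun _ => - mu));
  [apply is_Cderive_id | apply is_Cderive_const].
Qed.

Lemma near_neq (mu x0 : C) : x0 <> mu -> near x0 (fun x => x <> mu).
Proof.
intros H; apply near_C.
assert (Hr : (0 < Cmod (mu - x0))%R)
  by (apply Cmod_gt_0, Cminus_eq_contra; congruence).
exists (mkposreal _ Hr); simpl; intros y Hy ->; lra.
Qed.

Lemma csmooth_inv (n : nat) (mu x0 : C) : x0 <> mu ->
  csmooth n (fun x => / (x - mu)) x0.
Proof.
intros H; induction n as [|n IH]; [exact I|].
exists (fun x => (- (1)) * (/ (x - mu) * / (x - mu))); split.
- generalize (near_neq _ _ H); apply filter_imp; intros x Hx.
  replace (- (1) * (/ (x - mu) * / (x - mu))) with (- (/ (x - mu) * / (x - mu))) by cring.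
  now apply is_Cderive_inv.
- apply csmooth_scal, csmooth_mult; assumption.
Qed.

Lemma csmooth_pow (n k : nat) (f : C -> C) (x0 : C) :
  csmooth n f x0 -> csmooth n (fun x => f x ^ k) x0.
Proof.
intros Hf; induction k as [|k IH]; simpl; [apply csmooth_const|].
now apply csmooth_mult.
Qed.

Lemma csmooth_csum (n : nat) (F : nat -> C -> C) (N : nat) (x0 : C) :
  (forall k, csmooth n (F k) x0) -> csmooth n (fun x => csum (fun k => F k x) N) x0.
Proof.
intros HF; induction N as [|N IH].
- apply csmooth_ext with (2 := HF 0%nat).
  apply filter_forall; intros x; now rewrite csum_O.
- apply csmooth_ext with (fun x => csum (fun k => F k x) N + F (S N) x).
  + apply filter_forall; intros x; now rewrite csum_S.
  + now apply csmooth_plus.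
Qed.

(** [C_derive_n] adds derivatives on the outside, whereas the Taylor induction strips one from the
    inside. *)
Lemma C_derive_n_comm (f : C -> C) (n : nat) :
  C_derive_n f (S n) = C_derive_n (C_derive f) n.
Proof.
induction n as [|n IH]; [reflexivity|].
change (C_derive (C_derive_n f (S n)) = C_derive (C_derive_n (C_derive f) n)).
now rewrite IH.
Qed.

Lemma is_Cderive_poly (b : nat -> C) (n : nat) (mu x : C) :
  is_Cderive (fun y => csum (fun j => b j * (y - mu) ^ j) (S n)) x
     (csum (fun j => RtoC (INR (S j)) * b (S j) * (x - mu) ^ j) n).
Proof.
assert (HS : forall k, is_Cderive (fun y => b (S k) * (y - mu) ^ S k) x
           (RtoC (INR (S k)) * b (S k) * (x - mu) ^ k)).
{ intros k; replace (RtoC (INR (S k)) * b (S k) * (x - mu) ^ k) with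
    (b (S k) * (RtoC (INR (S k)) * (x - mu) ^ k)) by cring.
  apply is_Cderive_scal, is_Cderive_pow. }
induction n as [|n IH].
- rewrite csum_O.
  replace (RtoC (INR 1) * b 1%nat * (x - mu) ^ 0) with
    (0 + RtoC (INR 1) * b 1%nat * (x - mu) ^ 0) by cring.
  apply is_Cderive_ext with (fun y => b 0%nat + b 1%nat * (y - mu) ^ 1).
  + apply filter_forall; intros y; rewrite csum_S, csum_O; simpl; cring.
  + apply (is_Cderive_plus (fun _ => b 0%nat)); [apply is_Cderive_const | apply HS].
- rewrite csum_S.
  apply is_Cderive_ext with (fun y => csum (fun j => b j * (y - mu) ^ j) (S n)
    + b (S (S n)) * (y - mu) ^ S (S n)).
  + apply filter_forall; intros y; now rewrite (csum_S _ (S n)).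
  + apply is_Cderive_plus; [exact IH | apply HS].
Qed.

(** Differentiating once preserves the shape: the polynomial drops one degree, and
    [(x - mu)^(n+2) H] becomes [(x - mu)^(n+1) ((n+2) H + (x - mu) H')], whose cofactor has lost one
    order of smoothness. *)
Lemma C_derive_n_taylor (n : nat) (b : nat -> C) (H phi : C -> C) (mu : C) :
  csmooth n H mu ->
  near mu (fun x => phi x =
    csum (fun j => b j * (x - mu) ^ j) n + (x - mu) ^ S n * H x) ->
  C_derive_n phi n mu = RtoC (INR (Factorial.fact n)) * b n.
Proof.
revert b H phi; induction n as [|n IH]; intros b H phi Hs Hphi.
- simpl C_derive_n.
  rewrite (locally_singleton (T := AbsRing_UniformSpace C_AbsRing) _ _ Hphi), csum_O.
  simpl; cring.
- rewrite C_derive_n_comm.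
  pose proof (csmooth_pred _ _ _ Hs) as Hs0.
  destruct Hs as [H' [Hd Hs]].
  rewrite (IH (fun j => RtoC (INR (S j)) * b (S j))
    (fun x => RtoC (INR (S (S n))) * H x + (x - mu) * H' x)).
  + change (Factorial.fact (S n)) with (S n * Factorial.fact n)%nat.
    rewrite mult_INR, RtoC_mult; cring.
  + apply csmooth_plus; [now apply csmooth_scal|].
    apply csmooth_mult; [apply csmooth_sub | exact Hs].
  + apply (locally_locally (T := AbsRing_UniformSpace C_AbsRing)) in Hphi.
    generalize (filter_and _ _ Hphi Hd); apply filter_imp; intros x [Hx Hdx].
    apply is_Cderive_unique.
    apply is_Cderive_ext with (fun y => csum (fun j => b j * (y - mu) ^ j) (S n)
      + (y - mu) ^ S (S n) * H y).
    { revert Hx; apply filter_imp; intros y Hy; now rewrite Hy. }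
    replace (csum (fun j => RtoC (INR (S j)) * b (S j) * (x - mu) ^ j) n +
      (x - mu) ^ S n * (RtoC (INR (S (S n))) * H x + (x - mu) * H' x)) with
      (csum (fun j => RtoC (INR (S j)) * b (S j) * (x - mu) ^ j) n +
       (RtoC (INR (S (S n))) * (x - mu) ^ S n * H x + (x - mu) ^ S (S n) * H' x))
      by (simpl Cpow; cring).
    apply is_Cderive_plus; [apply is_Cderive_poly|].
    apply is_Cderive_mult; [apply is_Cderive_pow | exact Hdx].
Qed.

(** * Partial fractions *)

Lemma csum_rev (f : nat -> C) (n : nat) :
  csum f n = csum (fun k => f (n - k)%nat) n.
Proof.
induction n as [|n IH]; [now rewrite !csum_O|].
rewrite csum_S, (csum_shift (fun k => f (S n - k)%nat)), IH.
rewrite Nat.sub_0_r; simpl; cring.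
Qed.

Lemma csum_delta (f : nat -> C) (j n : nat) : (j <= n)%nat ->
  csum (fun k => if Nat.eqb k j then f k else RtoC 0) n = f j.
Proof.
assert (E : forall k, (k < j)%nat ->
  csum (fun k => if Nat.eqb k j then f k else RtoC 0) k = RtoC 0).
{ induction k as [|k IH]; intros Hk.
  - rewrite csum_O; destruct (Nat.eqb_spec 0 j); [lia | reflexivity].
  - rewrite csum_S, IH by lia; destruct (Nat.eqb_spec (S k) j); [lia | cring]. }
induction n as [|n IH]; intros Hj.
- rewrite csum_O; destruct (Nat.eqb_spec 0 j) as [->|]; [reflexivity | lia].
- rewrite csum_S; destruct (Nat.eqb_spec (S n) j) as [<-|].
  + rewrite E by lia; cring.
  + rewrite IH by lia; cring.
Qed.

Definition polar_part (b : nat -> C) (m : nat) (lam x : C) : C :=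
  csum (fun j => b j * / (x - lam) ^ S j) m.

(** Terms of order above [n] are absorbed into the remainder one by one. This serves to read all
    derivatives of order [m - r] from a single expansion to order [m]. *)
Lemma C_derive_n_taylor_le (n k : nat) (b : nat -> C) (H phi : C -> C) (mu : C) :
  csmooth n H mu ->
  near mu (fun x => phi x =
    csum (fun j => b j * (x - mu) ^ j) (n + k) + (x - mu) ^ S (n + k) * H x) ->
  C_derive_n phi n mu = RtoC (INR (Factorial.fact n)) * b n.
Proof.
revert H; induction k as [|k IH]; intros H Hs Hphi.
- rewrite Nat.add_0_r in Hphi; now apply C_derive_n_taylor with (1 := Hs).
- apply (IH (fun x => b (S (n + k)) + (x - mu) * H x)).
  + apply csmooth_plus; [apply csmooth_const|].
    apply csmooth_mult; [apply csmooth_sub | exact Hs].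
  + revert Hphi; apply filter_imp; intros x ->.
    rewrite Nat.add_succ_r, csum_S; simpl Cpow; cring.
Qed.

(** Multiplying by [(x - lam)^(m+1)] turns the polar part into a polynomial with reversed
    coefficients, so [b r] becomes the Taylor coefficient of order [m - r], which is what [a_coef]
    extracts. *)
Lemma a_coef_poles (m : nat) (z : R) (lam : C) (b : nat -> C) (H : C -> C) :
  (forall n, csmooth n H lam) ->
  near lam (fun x => x <> lam ->
    x ^ m * (1 - x) ^ (2 * m) / (x * (1 - x) ^ 2 - RtoC z) ^ S m
    = polar_part b m lam x + H x) ->
  forall r, (r <= m)%nat -> a_coef m z r lam = b r.
Proof.
intros Hs HH r Hr.
set (phi := fun x => csum (fun j => b (m - j)%nat * (x - lam) ^ j) m
  + (x - lam) ^ S m * H x).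
unfold a_coef.
set (f := fun x => x ^ m * (1 - x) ^ (2 * m) * (x - lam) ^ S m
                 / (x * (1 - x) ^ 2 - RtoC z) ^ S m).
assert (Hf : near lam (fun x => x <> lam -> f x = phi x)).
{ revert HH; apply filter_imp; intros x Hx Hne; specialize (Hx Hne).
  assert (Hd : x - lam <> 0) by now apply Cminus_eq_contra.
  unfold f, phi, Cdiv.
  replace (x ^ m * (1 - x) ^ (2 * m) * (x - lam) ^ S m
    * / (x * (1 - x) ^ 2 - RtoC z) ^ S m)
    with ((x - lam) ^ S m * (x ^ m * (1 - x) ^ (2 * m)
    / (x * (1 - x) ^ 2 - RtoC z) ^ S m)) by (unfold Cdiv; cring).
  rewrite Hx, Cmult_plus_distr_l; f_equal.
  unfold polar_part; rewrite <- csum_mult_l, csum_rev; apply csum_ext; intros k Hk.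
  replace (S m) with (S (m - k) + k)%nat by lia.
  rewrite Cpow_add_r; field; now apply Cpow_nz. }
assert (Hphi : csmooth 1 phi lam).
{ apply csmooth_plus.
  - apply (csmooth_csum 1 (fun j x => b (m - j)%nat * (x - lam) ^ j)).
    intros k; apply csmooth_scal, csmooth_pow, csmooth_sub.
  - apply csmooth_mult; [apply csmooth_pow, csmooth_sub | apply Hs]. }
(* [remove_singularity] fills the hole with [C_lim]; its value comes from the continuity of [phi],
   which equals [f] near [lam] except at [lam]. *)
assert (Hlim : C_lim f lam = phi lam).
{ apply is_C_lim_unique.
  destruct Hphi as [phi' [Hd _]].
  apply (locally_singleton (T := AbsRing_UniformSpace C_AbsRing)) in Hd.
  assert (Hc : continuous (T := AbsRing_UniformSpace C_AbsRing)
     (U := AbsRing_NormedModule C_AbsRing) phi lam).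
  { apply ex_derive_continuous; exists (phi' lam); exact Hd. }
  intros P HP; apply (proj1 (locally_C _ _)) in HP.
  specialize (Hc P HP).
  unfold filtermap in Hc |- *; unfold locally', within.
  apply (locally_C lam).
  generalize (filter_and _ _ Hc Hf); apply filter_imp.
  intros x [H1 H2] Hne; rewrite H2; assumption. }
rewrite (C_derive_n_taylor_le (m - r) r (fun j => b (m - j)%nat) H).
- replace (m - (m - r))%nat with r by lia.
  field; intros E; apply RtoC_inj in E; exact (INR_fact_neq_0 _ E).
- apply Hs.
- replace (m - r + r)%nat with m by lia.
  revert Hf; apply filter_imp; intros x Hx; unfold remove_singularity.
  destruct (Ceq_dec x lam) as [->|Hne]; [exact Hlim | now apply Hx].
Qed.

(** The coefficients stay anonymous: what matters at this stage is a linear space of functions that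
    is stable, up to raising [m] by one, under division by [x - p l]. *)
Definition pole_span (N : nat) (p : nat -> C) (m : nat) (f : C -> C) : Prop :=
  exists b : nat -> nat -> C, forall x, (forall l, (l <= N)%nat -> x <> p l) ->
    f x = csum (fun l => polar_part (b l) m (p l) x) N.

Section PoleSpan.

Variables (N : nat) (p : nat -> C).
Hypothesis Hp : forall k l, (k <= N)%nat -> (l <= N)%nat -> k <> l -> p k <> p l.

Notation off x := (forall l, (l <= N)%nat -> x <> p l).

Lemma pole_span_ext (m : nat) (f g : C -> C) :
  (forall x, off x -> f x = g x) -> pole_span N p m f -> pole_span N p m g.
Proof.
intros E [b Hb]; exists b; intros x Hx; rewrite <- E by exact Hx; now apply Hb.
Qed.

Lemma pole_span_plus (m : nat) (f g : C -> C) :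
  pole_span N p m f -> pole_span N p m g -> pole_span N p m (fun x => f x + g x).
Proof.
intros [b Hb] [c Hc]; exists (fun l j => b l j + c l j); intros x Hx.
rewrite Hb, Hc by exact Hx.
rewrite <- csum_plus; apply csum_ext; intros l _.
unfold polar_part; rewrite <- csum_plus; apply csum_ext; intros j _; cring.
Qed.

Lemma pole_span_scal (m : nat) (a : C) (f : C -> C) :
  pole_span N p m f -> pole_span N p m (fun x => a * f x).
Proof.
intros [b Hb]; exists (fun l j => a * b l j); intros x Hx.
rewrite Hb by exact Hx.
rewrite <- csum_mult_l; apply csum_ext; intros l _.
unfold polar_part; rewrite <- csum_mult_l; apply csum_ext; intros j _; cring.
Qed.

Lemma pole_span_csum (m : nat) (F : nat -> C -> C) (n : nat) :
  (forall k, (k <= n)%nat -> pole_span N p m (F k)) ->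
  pole_span N p m (fun x => csum (fun k => F k x) n).
Proof.
induction n as [|n IH]; intros HF.
- apply pole_span_ext with (F 0%nat); [intros x _; now rewrite csum_O | now apply HF].
- apply pole_span_ext with (fun x => csum (fun k => F k x) n + F (S n) x).
  + intros x _; now rewrite csum_S.
  + apply pole_span_plus; [apply IH; intros; apply HF; lia | now apply HF].
Qed.

Lemma pole_span_pole (m l j : nat) : (l <= N)%nat -> (j <= m)%nat ->
  pole_span N p m (fun x => / (x - p l) ^ S j).
Proof.
intros Hl Hj.
exists (fun l' j' => if Nat.eqb l' l then if Nat.eqb j' j then RtoC 1 else RtoC 0 else RtoC 0).
intros x _.
rewrite <- (csum_delta (fun l' => / (x - p l') ^ S j) l N Hl).
apply csum_ext; intros k _; unfold polar_part; destruct (Nat.eqb_spec k l) as [->|].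
- rewrite <- (csum_delta (fun j' => / (x - p l) ^ S j') j m Hj).
  apply csum_ext; intros i _; destruct (Nat.eqb i j); cring.
- symmetry; rewrite (csum_ext _ (fun j => RtoC 0 * RtoC 0)) by (intros; cring).
  rewrite csum_mult_l; cring.
Qed.

Lemma off_neq (x : C) (l : nat) : off x -> (l <= N)%nat -> x - p l <> 0.
Proof. intros Hx Hl; now apply Cminus_eq_contra, Hx. Qed.

(** For equal poles the order rises by one. For distinct ones, [1 / ((x - a) (x - b)) = (1 / (x - a)
    - 1 / (x - b)) / (a - b)] lowers the order at [p k] until two simple poles remain. *)
Lemma pole_span_pole_mult (m k l j : nat) :
  (k <= N)%nat -> (l <= N)%nat -> (j <= m)%nat ->
  pole_span N p (S m) (fun x => / (x - p k) ^ S j * / (x - p l)).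
Proof.
intros Hk Hl; destruct (Nat.eq_dec k l) as [->|Hkl].
- intros Hj; apply pole_span_ext with (fun x => / (x - p l) ^ S (S j)).
  + intros x Hx; pose proof (off_neq x l Hx Hl).
    simpl Cpow; field; split; try assumption; now apply Cpow_nz.
  + apply pole_span_pole; lia.
- assert (Hd : p k - p l <> 0) by (apply Cminus_eq_contra; now apply Hp).
  assert (Hd' : p l - p k <> 0) by (apply Cminus_eq_contra; apply Hp; auto).
  induction j as [|j IH]; intros Hj.
  + apply pole_span_ext with
      (fun x => / (p k - p l) * (/ (x - p k) ^ 1 + (- (1)) * / (x - p l) ^ 1)).
    * intros x Hx; pose proof (off_neq x l Hx Hl); pose proof (off_neq x k Hx Hk).
      simpl Cpow; field; repeat split; assumption.
    * apply pole_span_scal, pole_span_plus; [|apply pole_span_scal];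
        apply pole_span_pole; lia.
  + apply pole_span_ext with (fun x => / (p k - p l) *
      (/ (x - p k) ^ S (S j) + (- (1)) * (/ (x - p k) ^ S j * / (x - p l)))).
    * intros x Hx; pose proof (off_neq x l Hx Hl); pose proof (off_neq x k Hx Hk).
      simpl Cpow; field; repeat split; try assumption; now apply Cpow_nz.
    * apply pole_span_scal, pole_span_plus; [apply pole_span_pole; lia|].
      apply pole_span_scal, IH; lia.
Qed.

Lemma pole_span_mult (m l : nat) (f : C -> C) : (l <= N)%nat ->
  pole_span N p m f -> pole_span N p (S m) (fun x => f x * / (x - p l)).
Proof.
intros Hl [b Hb].
apply pole_span_ext with (fun x => csum (fun k =>
  csum (fun j => b k j * (/ (x - p k) ^ S j * / (x - p l))) m) N).
- intros x Hx; rewrite Hb by exact Hx; rewrite Cmult_comm, <- csum_mult_l.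
  apply csum_ext; intros k _; unfold polar_part; rewrite <- csum_mult_l.
  apply csum_ext; intros j _; cring.
- apply pole_span_csum; intros k Hk.
  apply (pole_span_csum (S m) (fun j x => b k j * (/ (x - p k) ^ S j * / (x - p l)))).
  intros j Hj; apply pole_span_scal, pole_span_pole_mult; assumption.
Qed.

Lemma pole_span_le (m : nat) (f : C -> C) :
  pole_span N p m f -> pole_span N p (S m) f.
Proof.
intros [b Hb].
apply pole_span_ext with (fun x => csum (fun k =>
  csum (fun j => b k j * / (x - p k) ^ S j) m) N).
- intros x Hx; now rewrite Hb by exact Hx.
- apply pole_span_csum; intros k Hk.
  apply (pole_span_csum (S m) (fun j x => b k j * / (x - p k) ^ S j)).
  intros j Hj; apply pole_span_scal, pole_span_pole; lia.
Qed.

End PoleSpan.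

Definition triple (z1 z2 z3 : C) (l : nat) : C :=
  match l with O => z1 | 1%nat => z2 | _ => z3 end.

(** Vieta by divided differences: subtracting two of the equations and cancelling the difference of
    the roots gives [E12] and [E13], and doing the same with these gives [z1 + z2 + z3 = 2]. *)
Lemma cubic_factor (z z1 z2 z3 : C) :
  z1 <> z2 /\ z1 <> z3 /\ z2 <> z3 ->
  z1 * (1 - z1) ^ 2 - z = 0 -> z2 * (1 - z2) ^ 2 - z = 0 ->
  z3 * (1 - z3) ^ 2 - z = 0 ->
  forall x, x * (1 - x) ^ 2 - z = (x - z1) * (x - z2) * (x - z3).
Proof.
intros [H12 [H13 H23]] H1 H2 H3 x.
assert (D : forall a b : C, a <> b -> forall c, (a - b) * c = 0 -> c = 0).
{ intros a b Hab c Hc; destruct (Ceq_dec c 0) as [|Hn]; [assumption|].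
  exfalso; apply (Cmult_neq_0 (a - b) c); auto using Cminus_eq_contra. }
assert (E12 : z1 * z1 + z1 * z2 + z2 * z2 - 2 * (z1 + z2) + 1 = 0).
{ apply (D z1 z2 H12).
  replace (RtoC 0) with ((z1 * (1 - z1) ^ 2 - z) - (z2 * (1 - z2) ^ 2 - z))
    by (rewrite H1, H2; ring).
  ring. }
assert (E13 : z1 * z1 + z1 * z3 + z3 * z3 - 2 * (z1 + z3) + 1 = 0).
{ apply (D z1 z3 H13).
  replace (RtoC 0) with ((z1 * (1 - z1) ^ 2 - z) - (z3 * (1 - z3) ^ 2 - z))
    by (rewrite H1, H3; ring).
  ring. }
assert (Es : z1 + z2 + z3 - 2 = 0).
{ apply (D z2 z3 H23).
  replace (RtoC 0) with ((z1 * z1 + z1 * z2 + z2 * z2 - 2 * (z1 + z2) + 1) -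
    (z1 * z1 + z1 * z3 + z3 * z3 - 2 * (z1 + z3) + 1)) by (rewrite E12, E13; ring).
  ring. }
assert (E3 : z3 = 2 - z1 - z2)
  by (transitivity (z3 - (z1 + z2 + z3 - 2)); [rewrite Es; ring | ring]).
assert (Ez : z = z1 * (1 - z1) ^ 2).
{ rewrite <- (Cplus_0_r z), <- H1; ring. }
rewrite E3, Ez; apply Ceq_minus.
(* After elimination of [z3] and [z], the two sides differ by [x - z1] times the left side of
   [E12]. *)
transitivity ((x - z1) * (z1 * z1 + z1 * z2 + z2 * z2 - 2 * (z1 + z2) + 1)).
- ring.
- rewrite E12; ring.
Qed.

(** Induction on [m] through [u / (u - z) = 1 + z / (u - z)]: passing from [m] to [m + 1] multiplies
    by this factor, and [1 / (u - z)] is itself a sum of simple poles. *)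
Lemma partial_fractions (m : nat) (z : R) (z1 z2 z3 : C) :
  z1 <> z2 /\ z1 <> z3 /\ z2 <> z3 ->
  z1 * (1 - z1) ^ 2 - RtoC z = 0 -> z2 * (1 - z2) ^ 2 - RtoC z = 0 ->
  z3 * (1 - z3) ^ 2 - RtoC z = 0 ->
  pole_span 2 (triple z1 z2 z3) m
    (fun x => x ^ m * (1 - x) ^ (2 * m) / (x * (1 - x) ^ 2 - RtoC z) ^ S m).
Proof.
intros Hdist H1 H2 H3.
set (p := triple z1 z2 z3).
pose proof (cubic_factor _ _ _ _ Hdist H1 H2 H3) as Hfac.
destruct Hdist as [H12 [H13 H23]].
assert (Hp : forall k l, (k <= 2)%nat -> (l <= 2)%nat -> k <> l -> p k <> p l).
{ intros [|[|[|k]]] [|[|[|l]]] Hk Hl Hkl; simpl; try lia; congruence. }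
assert (D12 : z1 - z2 <> 0) by now apply Cminus_eq_contra.
assert (D13 : z1 - z3 <> 0) by now apply Cminus_eq_contra.
assert (D23 : z2 - z3 <> 0) by now apply Cminus_eq_contra.
(* The residues of [1 / (u - z)], that is the inverses of the products of root differences, with
   signs arranged so that only [z1 - z2], [z1 - z3] and [z2 - z3] occur. *)
set (al := triple (/ ((z1 - z2) * (z1 - z3))) (/ (- (z1 - z2) * (z2 - z3)))
                 (/ ((z1 - z3) * (z2 - z3)))).
assert (Hoff : forall x, (forall l, (l <= 2)%nat -> x <> p l) ->
  x - z1 <> 0 /\ x - z2 <> 0 /\ x - z3 <> 0).
{ intros x Hx; repeat split; apply Cminus_eq_contra;
    [apply (Hx 0%nat) | apply (Hx 1%nat) | apply (Hx 2%nat)]; lia. }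
assert (HE : forall x, (forall l, (l <= 2)%nat -> x <> p l) ->
  / (x * (1 - x) ^ 2 - RtoC z) = csum (fun l => al l * / (x - p l)) 2).
{ intros x Hx; destruct (Hoff x Hx) as [X1 [X2 X3]].
  rewrite Hfac, !csum_S, csum_O; simpl.
  field; repeat split; auto. }
induction m as [|m IH].
- apply pole_span_ext with (fun x => csum (fun l => al l * / (x - p l) ^ 1) 2).
  + intros x Hx; transitivity (/ (x * (1 - x) ^ 2 - RtoC z)).
    * rewrite HE by exact Hx; apply csum_ext; intros l _; now rewrite Cpow_1_r.
    * simpl Cpow; unfold Cdiv; rewrite !Cmult_1_r, Cmult_1_l; reflexivity.
  + apply (pole_span_csum 2 p 0 (fun l x => al l * / (x - p l) ^ 1)); intros l Hl.
    apply pole_span_scal, pole_span_pole; lia.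
- set (f := fun x => x ^ m * (1 - x) ^ (2 * m) / (x * (1 - x) ^ 2 - RtoC z) ^ S m) in *.
  apply pole_span_ext with (fun x => f x +
    RtoC z * csum (fun l => al l * (f x * / (x - p l))) 2).
  + intros x Hx; destruct (Hoff x Hx) as [X1 [X2 X3]].
    assert (Hn : x * (1 - x) ^ 2 - RtoC z <> 0).
    { rewrite Hfac; repeat apply Cmult_neq_0; assumption. }
    transitivity (f x + RtoC z * (f x * / (x * (1 - x) ^ 2 - RtoC z))).
    * rewrite HE by exact Hx; rewrite <- (csum_mult_l (f x)); do 2 f_equal.
      apply csum_ext; intros; cring.
    * unfold f; replace (2 * S m)%nat with (2 * m + 2)%nat by lia.
      rewrite Cpow_add_r, !(Cpow_S (x * (1 - x) ^ 2 - RtoC z)), (Cpow_S x).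
      assert (Hn' := Cpow_nz _ m Hn).
      set (W := (x * (1 - x) ^ 2 - RtoC z) ^ m) in *.
      field; split; [exact Hn' | exact Hn].
  + apply pole_span_plus; [now apply pole_span_le|].
    apply pole_span_scal.
    apply (pole_span_csum 2 p (S m) (fun l x => al l * (f x * / (x - p l)))).
    intros l Hl; now apply pole_span_scal, pole_span_mult.
Qed.

(** Near one root the polar parts at the other two are smooth, so they can play the role of [H] in
    [a_coef_poles]; this is done at each root in turn. *)
Lemma a_coef_partial_fractions (m : nat) (z : R) (z1 z2 z3 : C) :
  z1 <> z2 /\ z1 <> z3 /\ z2 <> z3 ->
  z1 * (1 - z1) ^ 2 - RtoC z = 0 -> z2 * (1 - z2) ^ 2 - RtoC z = 0 ->
  z3 * (1 - z3) ^ 2 - RtoC z = 0 ->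
  forall x, x <> z1 -> x <> z2 -> x <> z3 ->
    x ^ m * (1 - x) ^ (2 * m) / (x * (1 - x) ^ 2 - RtoC z) ^ S m
    = polar_part (fun j => a_coef m z j z1) m z1 x
    + polar_part (fun j => a_coef m z j z2) m z2 x
    + polar_part (fun j => a_coef m z j z3) m z3 x.
Proof.
intros Hdist H1 H2 H3.
destruct (partial_fractions m z z1 z2 z3 Hdist H1 H2 H3) as [b Hb].
destruct Hdist as [H12 [H13 H23]].
assert (Hb' : forall x, x <> z1 -> x <> z2 -> x <> z3 ->
  x ^ m * (1 - x) ^ (2 * m) / (x * (1 - x) ^ 2 - RtoC z) ^ S m =
  polar_part (b 0%nat) m z1 x + polar_part (b 1%nat) m z2 x + polar_part (b 2%nat) m z3 x).
{ intros x X1 X2 X3; rewrite Hb; [now rewrite !csum_S, csum_O|].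
  intros [|[|l]] _; assumption. }
assert (HS : forall c l mu n, mu <> l -> csmooth n (polar_part c m l) mu).
{ intros c l mu n Hne.
  apply csmooth_ext with (fun x => csum (fun j => c j * (/ (x - l)) ^ S j) m).
  - generalize (near_neq _ _ Hne); apply filter_imp; intros x Hx.
    unfold polar_part; apply csum_ext; intros k _.
    rewrite Cpow_inv; [reflexivity | now apply Cminus_eq_contra].
  - apply (csmooth_csum n (fun j x => c j * (/ (x - l)) ^ S j)); intros k.
    now apply csmooth_scal, csmooth_pow, csmooth_inv. }
assert (A1 : forall r, (r <= m)%nat -> a_coef m z r z1 = b 0%nat r).
{ apply a_coef_poles with (fun x => polar_part (b 1%nat) m z2 x + polar_part (b 2%nat) m z3 x).
  - intros n; apply csmooth_plus; apply HS; congruence.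
  - generalize (filter_and _ _ (near_neq z2 z1 H12) (near_neq z3 z1 H13)).
    apply filter_imp; intros x [X2 X3] X1; rewrite Hb' by assumption; cring. }
assert (A2 : forall r, (r <= m)%nat -> a_coef m z r z2 = b 1%nat r).
{ apply a_coef_poles with (fun x => polar_part (b 0%nat) m z1 x + polar_part (b 2%nat) m z3 x).
  - intros n; apply csmooth_plus; apply HS; congruence.
  - generalize (filter_and _ _ (near_neq z1 z2 (not_eq_sym H12)) (near_neq z3 z2 H23)).
    apply filter_imp; intros x [X1 X3] X2; rewrite Hb' by assumption; cring. }
assert (A3 : forall r, (r <= m)%nat -> a_coef m z r z3 = b 2%nat r).
{ apply a_coef_poles with (fun x => polar_part (b 0%nat) m z1 x + polar_part (b 1%nat) m z2 x).
  - intros n; apply csmooth_plus; apply HS; congruence.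
  - generalize (filter_and _ _ (near_neq z1 z3 (not_eq_sym H13))
      (near_neq z2 z3 (not_eq_sym H23))).
    apply filter_imp; intros x [X1 X2] X3; rewrite Hb' by assumption; cring. }
intros x X1 X2 X3; rewrite Hb' by assumption.
unfold polar_part; f_equal; [f_equal|]; apply csum_ext; intros j Hj;
  rewrite ?A1, ?A2, ?A3 by exact Hj; reflexivity.
Qed.

(** * The functional [f |-> int_0^1 ln x * f x dx] *)

Open Scope R_scope.

(* [v = int_0^1 ln x * f x dx], integrated by parts twice. *)
Definition log_moment (f : R -> R) (v : R) : Prop :=
  exists P Q : R -> R,
    (forall x, 0 <= x <= 1 ->
       is_derive P x (Q x) /\ is_derive (fun y => y * Q y) x (f x)) /\
    v = P 0 - P 1.

Lemma log_moment_plus (f g : R -> R) (u v : R) :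
  log_moment f u -> log_moment g v -> log_moment (fun x => f x + g x) (u + v).
Proof.
intros (P & Q & H & ->) (P' & Q' & H' & ->).
exists (fun x => P x + P' x), (fun x => Q x + Q' x); split; [|ring].
intros x Hx; destruct (H x Hx) as [H1 H2], (H' x Hx) as [H1' H2']; split.
- now apply (is_derive_plus (K := R_AbsRing) (V := R_NormedModule) P P').
- apply is_derive_ext with (fun y => y * Q y + y * Q' y); [intros; simpl; ring|].
  now apply (is_derive_plus (K := R_AbsRing) (V := R_NormedModule)
    (fun y => y * Q y) (fun y => y * Q' y)).
Qed.

Lemma log_moment_scal (a : R) (f : R -> R) (v : R) :
  log_moment f v -> log_moment (fun x => a * f x) (a * v).
Proof.
intros (P & Q & H & ->).
exists (fun x => a * P x), (fun x => a * Q x); split; [|ring].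
intros x Hx; destruct (H x Hx) as [H1 H2]; split.
- now apply is_derive_scal.
- apply is_derive_ext with (fun y => a * (y * Q y)); [intros; simpl; ring|].
  now apply is_derive_scal.
Qed.

Lemma log_moment_ext (f g : R -> R) (v : R) :
  (forall x, 0 <= x <= 1 -> f x = g x) -> log_moment f v -> log_moment g v.
Proof.
intros E (P & Q & H & ->); exists P, Q; split; [|reflexivity].
intros x Hx; rewrite <- E by exact Hx; now apply H.
Qed.

Lemma log_moment_minus (f g : R -> R) (u v : R) :
  log_moment f u -> log_moment g v -> log_moment (fun x => f x - g x) (u - v).
Proof.
intros Hf Hg; replace (u - v) with (u + (-1) * v) by ring.
apply log_moment_ext with (fun x => f x + (-1) * g x); [intros; ring|].
now apply log_moment_plus, log_moment_scal.
Qed.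

Lemma log_moment_sum (F : nat -> R -> R) (v : nat -> R) (n : nat) :
  (forall k, log_moment (F k) (v k)) ->
  log_moment (fun x => sum_n (fun k => F k x) n) (sum_n v n).
Proof.
intros H; induction n as [|n IH].
- rewrite sum_O; apply log_moment_ext with (F 0%nat); [|apply H].
  intros; now rewrite sum_O.
- rewrite sum_Sn; apply log_moment_ext with (fun x => sum_n (fun k => F k x) n + F (S n) x).
  + intros; now rewrite sum_Sn.
  + apply log_moment_plus; [exact IH | apply H].
Qed.

(** The constant 1 in front of [B] reflects [int_0^1 |ln x| dx = 1]. With [B = 0] the lemma also
    shows that the zero function has no moment other than 0. *)
Lemma log_moment_bound (f : R -> R) (v B : R) :
  log_moment f v -> (forall x, 0 <= x <= 1 -> Rabs (f x) <= B) -> Rabs v <= B.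
Proof.
intros (P & Q & H & ->) HB.
assert (HQ : forall x, 0 < x <= 1 -> Rabs (Q x) <= B).
{ intros x Hx.
  (* [y * Q y] vanishes at 0, so the mean value theorem gives [x Q x = x f c]. *)
  destruct (MVT_cor2 (fun y => y * Q y) f 0 x) as (c & Hc & Hc'); [lra| |].
  - intros c Hc; apply is_derive_Reals, H; lra.
  - replace (Q x) with (f c); [apply HB; lra|].
    apply Rmult_eq_reg_r with x; lra. }
destruct (MVT_cor2 P Q 0 1) as (c & Hc & Hc'); [lra| |].
- intros c Hc; apply is_derive_Reals, H; lra.
- replace (P 0 - P 1) with (- Q c) by lra.
  rewrite Rabs_Ropp; apply HQ; lra.
Qed.

Lemma is_derive_pow_id (n : nat) (x : R) :
  is_derive (fun y => y ^ S n) x (INR (S n) * x ^ n).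
Proof.
replace (INR (S n) * x ^ n) with (INR (S n) * 1 * x ^ pred (S n)) by (simpl pred; ring).
apply (is_derive_pow (fun y => y)), (is_derive_id (K := R_AbsRing)).
Qed.

Lemma log_moment_pow (n : nat) : log_moment (fun x => x ^ n) (- / (INR (S n)) ^ 2).
Proof.
assert (Hn : INR (S n) <> 0) by (apply not_0_INR; lia).
exists (fun x => / (INR (S n)) ^ 2 * x ^ S n), (fun x => / INR (S n) * x ^ n).
split.
- intros x _; split.
  + replace (/ INR (S n) * x ^ n) with (/ (INR (S n)) ^ 2 * (INR (S n) * x ^ n))
      by (field; exact Hn).
    apply is_derive_scal, is_derive_pow_id.
  + apply is_derive_ext with (fun y => / INR (S n) * y ^ S n).
    { intros y; simpl; ring. }
    pose proof (is_derive_scal _ x (/ INR (S n)) _ (is_derive_pow_id n x)) as H.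
    replace (/ INR (S n) * (INR (S n) * x ^ n)) with (x ^ n) in H by (field; exact Hn).
    exact H.
- rewrite pow1; simpl; field; exact Hn.
Qed.

(** * Moments of Beta type and summation of the series *)

Lemma harmonic_S (n : nat) : harmonic (S n) = harmonic n + / INR (S n).
Proof. unfold harmonic; rewrite sum_n_Sm by lia; reflexivity. Qed.

(** The value is the derivative in [a] of [a! b! / (a + b + 1)!]. Induction on [b], for all [a] at
    once, by [x^a (1-x)^(b+1) = x^a (1-x)^b - x^(a+1) (1-x)^b]. *)
Lemma log_moment_beta (a b : nat) :
  log_moment (fun x => x ^ a * (1 - x) ^ b)
    (- (INR (Factorial.fact a) * INR (Factorial.fact b)
        / INR (Factorial.fact (a + b + 1))
        * (harmonic (a + b + 1) - harmonic a))).
Proof.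
assert (Hf : forall k, INR (Factorial.fact (S k)) = INR (S k) * INR (Factorial.fact k)).
{ intros k; rewrite <- mult_INR; reflexivity. }
revert a; induction b as [|b IH]; intros a.
- replace (a + 0 + 1)%nat with (S a) by lia.
  assert (Ha : INR (S a) <> 0) by (apply not_0_INR; lia).
  pose proof (INR_fact_neq_0 a).
  replace (- _) with (- / (INR (S a)) ^ 2).
  + apply log_moment_ext with (2 := log_moment_pow a); intros; simpl; ring.
  + rewrite harmonic_S, Hf; simpl (Factorial.fact 0); simpl (INR 1).
    field; split; assumption.
- apply log_moment_ext with
    (fun x => x ^ a * (1 - x) ^ b - x ^ S a * (1 - x) ^ b).
  { intros x _; simpl; ring. }
  replace (- _) with
    (- (INR (Factorial.fact a) * INR (Factorial.fact b)
        / INR (Factorial.fact (a + b + 1))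
        * (harmonic (a + b + 1) - harmonic a)) -
     - (INR (Factorial.fact (S a)) * INR (Factorial.fact b)
        / INR (Factorial.fact (S a + b + 1))
        * (harmonic (S a + b + 1) - harmonic (S a)))).
  + apply log_moment_minus; apply IH.
  + replace (S a + b + 1)%nat with (S (a + b + 1)) by lia.
    replace (a + S b + 1)%nat with (S (a + b + 1)) by lia.
    rewrite !harmonic_S, !Hf.
    pose proof (INR_fact_neq_0 (a + b + 1)).
    replace (INR (S (a + b + 1))) with (INR a + INR b + 2)
      by (rewrite S_INR, !plus_INR; simpl; ring).
    rewrite (S_INR a), (S_INR b).
    pose proof (pos_INR a); pose proof (pos_INR b).
    field; repeat split; lra.
Qed.

Lemma fact_factorial (n : nat) : ssrnat.factorial n = Factorial.fact n.
Proof.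
induction n as [|n IH]; [reflexivity|].
rewrite ssrnat.factS, IH; reflexivity.
Qed.

Lemma binom_Pascal (k m : nat) :
  INR (binom (S k) (S m)) = INR (binom k (S m)) + INR (binom k m).
Proof. rewrite binomial.binS, <- plus_INR; reflexivity. Qed.

Lemma binom_fact (k : nat) :
  INR (binom (3 * k) k) * (INR (Factorial.fact k) * INR (Factorial.fact (2 * k)))
  = INR (Factorial.fact (3 * k)).
Proof.
assert (H : ssrnat.leq k (3 * k) = true) by (apply (ssrbool.introT ssrnat.leP); lia).
pose proof (binomial.bin_fact H) as E; rewrite !fact_factorial in E.
change (binom (3 * k) k * (Factorial.fact k * Factorial.fact (3 * k - k)) =
        Factorial.fact (3 * k))%nat in E.
replace (3 * k - k)%nat with (2 * k)%nat in E by lia.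
now rewrite <- E, !mult_INR.
Qed.

Lemma binom_fact_pos (k : nat) : 0 < INR (binom (3 * k) k).
Proof.
destruct (Rle_lt_dec (INR (binom (3 * k) k)) 0) as [H|H]; [|exact H].
pose proof (pos_INR (binom (3 * k) k)).
pose proof (INR_fact_lt_0 (3 * k)) as H1; rewrite <- binom_fact in H1.
replace (INR (binom (3 * k) k)) with 0 in H1 by lra; lra.
Qed.

Lemma rsum_mult_l (a : R) (f : nat -> R) (n : nat) :
  sum_n (fun k => a * f k) n = a * sum_n f n.
Proof. exact (sum_n_mult_l (K := R_Ring) a f n). Qed.

Lemma rsum_plus (f g : nat -> R) (n : nat) :
  sum_n (fun k => f k + g k) n = sum_n f n + sum_n g n.
Proof. exact (sum_n_plus (G := R_AbelianMonoid) f g n). Qed.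

(* By Pascal's rule the remainders satisfy
   [R (m+1) (N+1) = q * (R (m+1) N + R m N)]. *)
Lemma binom_geom_remainder (q : R) (m N : nat) : Rabs q <= / 4 ->
  Rabs (q ^ m / (1 - q) ^ S m - sum_n (fun k => INR (binom k m) * q ^ k) N)
  <= 2 * (/ 2) ^ N.
Proof.
intros Hq; revert m.
assert (Hq' : - / 4 <= q <= / 4) by now apply Rabs_le_between.
assert (H1q : 1 - q <> 0) by lra.
assert (Hi : / (1 - q) <= 4 / 3).
{ replace (4 / 3) with (/ (3 / 4)) by field; apply Rinv_le_contravar; lra. }
assert (Hi0 : 0 < / (1 - q)) by (apply Rinv_0_lt_compat; lra).
assert (Hb0 : forall k, INR (binom k 0) = 1) by (intros; now rewrite binomial.bin0).
assert (Hshift : forall f N, sum_n f (S N) = f 0%nat + sum_n (fun k => f (S k)) N).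
{ clear; intros f N; induction N as [|N IH].
  - now rewrite sum_Sn, !sum_O.
  - rewrite sum_Sn, IH, sum_Sn; unfold plus; simpl; ring. }
induction N as [|N IH]; intros m.
(* For [N = 0] the remainder is [q / (1 - q)] when [m = 0], and otherwise at most
   [1 / (1 - q) <= 4/3], because [|q / (1 - q)| <= 1/3]. *)
- rewrite sum_O; destruct m as [|m].
  + rewrite Hb0.
    replace (q ^ 0 / (1 - q) ^ 1 - 1 * q ^ 0) with (q * / (1 - q)) by (simpl; field; lra).
    rewrite Rabs_mult, (Rabs_pos_eq (/ (1 - q))) by lra.
    pose proof (Rabs_pos q); simpl; nra.
  + replace (INR (binom 0 (S m))) with 0 by reflexivity.
    replace (q ^ S m / (1 - q) ^ S (S m) - 0 * q ^ 0) with
      ((q * / (1 - q)) ^ S m * / (1 - q)).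
    2:{ rewrite Rpow_mult_distr, pow_inv; simpl; field; split; [apply pow_nonzero|]; lra. }
    rewrite Rabs_mult, (Rabs_pos_eq (/ (1 - q))) by lra.
    rewrite <- RPow_abs, Rabs_mult, (Rabs_pos_eq (/ (1 - q))) by lra.
    pose proof (Rabs_pos q).
    assert ((Rabs q * / (1 - q)) ^ S m <= 1 ^ S m).
    { apply pow_incr; nra. }
    rewrite pow1 in *; simpl pow at 2; nra.
- destruct m as [|m].
  + replace (q ^ 0 / (1 - q) ^ 1 - sum_n (fun k => INR (binom k 0) * q ^ k) (S N))
      with (q * (q ^ 0 / (1 - q) ^ 1 - sum_n (fun k => INR (binom k 0) * q ^ k) N)).
    * rewrite Rabs_mult; specialize (IH 0%nat).
      pose proof (Rabs_pos q); pose proof (pow_lt (/ 2) N ltac:(lra)).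
      simpl pow in *; nra.
    * rewrite Hshift, Hb0.
      rewrite (sum_n_ext (fun k => INR (binom (S k) 0) * q ^ S k)
        (fun k => q * (INR (binom k 0) * q ^ k))).
      2:{ intros k; rewrite !Hb0; simpl; ring. }
      rewrite rsum_mult_l; simpl; field; lra.
  + replace (q ^ S m / (1 - q) ^ S (S m) -
      sum_n (fun k => INR (binom k (S m)) * q ^ k) (S N)) with
      (q * ((q ^ S m / (1 - q) ^ S (S m) - sum_n (fun k => INR (binom k (S m)) * q ^ k) N)
          + (q ^ m / (1 - q) ^ S m - sum_n (fun k => INR (binom k m) * q ^ k) N))).
    (* Both remainders are at most [2 / 2^N], and [|q| <= 1/4] turns their sum into [1 / 2^N], which
       is the bound for [N + 1]. *)
    * rewrite Rabs_mult.
      pose proof (IH m) as IH1; pose proof (IH (S m)) as IH2.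
      set (A := q ^ m / _ - _) in *; set (B := q ^ S m / _ - _) in *.
      pose proof (Rabs_triang B A).
      pose proof (Rabs_pos q); pose proof (pow_lt (/ 2) N ltac:(lra)).
      change ((/ 2) ^ S N) with (/ 2 * (/ 2) ^ N).
      pose proof (Rabs_pos (B + A)); nra.
    * rewrite Hshift; replace (INR (binom 0 (S m))) with 0 by reflexivity.
      rewrite (sum_n_ext (fun k => INR (binom (S k) (S m)) * q ^ S k)
        (fun k => q * (INR (binom k (S m)) * q ^ k + INR (binom k m) * q ^ k))).
      2:{ intros k; rewrite binom_Pascal; simpl; ring. }
      rewrite rsum_mult_l, rsum_plus; simpl; field.
      repeat split; try (apply pow_nonzero); lra.
Qed.

(** The Beta moment with exponents [k] and [2k], where [k! (2k)! / (3k+1)! = 1 / ((3k+1)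
    binom(3k,k))]; the minus sign is that of [ln] on [(0,1)]. *)
Lemma lhs_term_log_moment (m : nat) (z : R) (k : nat) :
  log_moment (fun x => INR (binom k m) / z ^ (k + 1) * (x * (1 - x) ^ 2) ^ k)
    (- lhs_term m z k).
Proof.
pose proof (log_moment_scal (INR (binom k m) / z ^ (k + 1)) _ _
  (log_moment_beta k (2 * k))) as H.
replace (- lhs_term m z k) with (INR (binom k m) / z ^ (k + 1) *
  - (INR (Factorial.fact k) * INR (Factorial.fact (2 * k))
     / INR (Factorial.fact (k + 2 * k + 1))
     * (harmonic (k + 2 * k + 1) - harmonic k))).
- apply log_moment_ext with (2 := H); intros x _.
  now rewrite pow_mult, Rpow_mult_distr.
- replace (k + 2 * k + 1)%nat with (3 * k + 1)%nat by lia.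
  unfold lhs_term.
  replace (INR (Factorial.fact (3 * k + 1))) with
    (INR (3 * k + 1) * (INR (binom (3 * k) k) *
       (INR (Factorial.fact k) * INR (Factorial.fact (2 * k))))).
  2:{ rewrite binom_fact, <- mult_INR; f_equal.
      replace (3 * k + 1)%nat with (S (3 * k)) by lia; reflexivity. }
  pose proof (binom_fact_pos k).
  pose proof (INR_fact_neq_0 k); pose proof (INR_fact_neq_0 (2 * k)).
  assert (INR (3 * k + 1) <> 0) by (apply not_0_INR; lia).
  unfold Rdiv; set (w := / z ^ (k + 1)); field; repeat split; try assumption; lra.
Qed.

(** The sharp maximum is [4/27], at [x = 1/3]; the cruder [1/4], from [x (1 - x) <= 1/4], suffices
    for a geometric rate. *)
Lemma cubic_range (x : R) : 0 <= x <= 1 -> 0 <= x * (1 - x) ^ 2 <= / 4.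
Proof.
intros Hx; split; [apply Rmult_le_pos; [lra | apply pow2_ge_0]|].
apply Rle_trans with (x * (1 - x)).
- apply Rmult_le_compat_l; [lra|]; simpl; nra.
- pose proof (Rle_0_sqr (2 * x - 1)); unfold Rsqr in *; nra.
Qed.

(** Sum and integral are never interchanged: for each [N] the moment of the full integrand minus the
    partial sum is bounded by the supremum of the tail, uniformly in [x]. *)
Lemma is_series_lhs_term (m : nat) (z V : R) : 1 <= Rabs z ->
  log_moment (fun x => (x * (1 - x) ^ 2) ^ m / (z - x * (1 - x) ^ 2) ^ S m) V ->
  is_series (lhs_term m z) (- V).
Proof.
intros Hz HV.
assert (Hz0 : z <> 0) by (intros ->; rewrite Rabs_R0 in Hz; lra).
assert (HN : forall N, Rabs (V + sum_n (lhs_term m z) N) <= 2 * (/ 2) ^ N).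
{ intros N.
  replace (V + sum_n (lhs_term m z) N) with (V - sum_n (fun k => - lhs_term m z k) N).
  2:{ rewrite (sum_n_ext (fun k => - lhs_term m z k) (fun k => -1 * lhs_term m z k))
        by (intros; simpl; ring).
      rewrite rsum_mult_l; ring. }
  apply log_moment_bound with (1 := log_moment_minus _ _ _ _ HV
    (log_moment_sum _ _ N (lhs_term_log_moment m z))).
  intros x Hx.
  pose proof (cubic_range x Hx) as Hu; set (u := x * (1 - x) ^ 2) in *.
  assert (Hiz : Rabs (/ z) <= 1).
  { rewrite Rabs_inv; rewrite <- Rinv_1; apply Rinv_le_contravar; lra. }
  assert (Hq : Rabs (u * / z) <= / 4).
  { rewrite Rabs_mult, (Rabs_pos_eq u) by lra; pose proof (Rabs_pos (/ z)); nra. }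
  assert (Hzu : z - u <> 0).
  { intros E; replace z with u in Hz by lra; rewrite Rabs_pos_eq in Hz by lra; lra. }
  (* With [q = u / z] the tail is [1 / z] times the remainder of the binomial generating series, and
     [|1 / z| <= 1]. *)
  replace (u ^ m / (z - u) ^ S m -
    sum_n (fun k => INR (binom k m) / z ^ (k + 1) * u ^ k) N) with
    (/ z * ((u * / z) ^ m / (1 - u * / z) ^ S m -
      sum_n (fun k => INR (binom k m) * (u * / z) ^ k) N)).
  - rewrite Rabs_mult.
    pose proof (binom_geom_remainder _ m N Hq).
    pose proof (Rabs_pos (/ z)).
    set (T := (u * / z) ^ m / _ - _) in *; pose proof (Rabs_pos T); nra.
  - rewrite Rmult_minus_distr_l; f_equal.
    + replace (1 - u * / z) with ((z - u) * / z) by (field; exact Hz0).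
      rewrite !Rpow_mult_distr, !pow_inv; simpl.
      field; repeat split; try assumption; now apply pow_nonzero.
    + transitivity (sum_n (fun k => / z * (INR (binom k m) * (u * / z) ^ k)) N).
      * now rewrite rsum_mult_l.
      * apply sum_n_ext; intros k; rewrite Rpow_mult_distr, pow_inv, pow_add.
        simpl; field; split; [exact Hz0 | now apply pow_nonzero]. }
assert (HL : is_lim_seq (sum_n (lhs_term m z)) (- V)); [|exact HL].
apply is_lim_seq_ext with (fun N => (V + sum_n (lhs_term m z) N) + (- V)).
{ intros; ring. }
replace (Finite (- V)) with (Finite (0 + - V)) by (f_equal; ring).
apply is_lim_seq_plus'; [|apply is_lim_seq_const].
apply is_lim_seq_abs_0.
apply is_lim_seq_le_le with (fun _ => 0) (fun N => 2 * (/ 2) ^ N).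
- intros N; split; [apply Rabs_pos | apply HN].
- apply is_lim_seq_const.
- replace (Finite 0) with (Rbar_mult 2 0) by (simpl; f_equal; ring).
  apply is_lim_seq_scal_l, is_lim_seq_geom; rewrite Rabs_pos_eq; lra.
Qed.

(** * Complex-valued functions of a real variable *)

Open Scope C_scope.

Definition is_RCderive (f : R -> C) (x : R) (l : C) : Prop :=
  is_derive (fun y => Re (f y)) x (Re l) /\ is_derive (fun y => Im (f y)) x (Im l).

Lemma is_RCderive_ext (f g : R -> C) (x : R) (l : C) :
  locally x (fun y => f y = g y) -> is_RCderive f x l -> is_RCderive g x l.
Proof.
intros E [H1 H2]; split.
- apply is_derive_ext_loc with (2 := H1); revert E; apply filter_imp; now intros y ->.
- apply is_derive_ext_loc with (2 := H2); revert E; apply filter_imp; now intros y ->.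
Qed.

Lemma is_RCderive_plus (f g : R -> C) (x : R) (df dg : C) :
  is_RCderive f x df -> is_RCderive g x dg -> is_RCderive (fun y => f y + g y) x (df + dg).
Proof.
intros [H1 H2] [H3 H4]; split.
- exact (is_derive_plus (K := R_AbsRing) (V := R_NormedModule) _ _ _ _ _ H1 H3).
- exact (is_derive_plus (K := R_AbsRing) (V := R_NormedModule) _ _ _ _ _ H2 H4).
Qed.

Lemma is_RCderive_const (a : C) (x : R) : is_RCderive (fun _ => a) x 0.
Proof.
split; [exact (is_derive_const (K := R_AbsRing) (V := R_NormedModule) (Re a) x)
       | exact (is_derive_const (K := R_AbsRing) (V := R_NormedModule) (Im a) x)].
Qed.

Lemma is_RCderive_scal (a : C) (f : R -> C) (x : R) (df : C) :
  is_RCderive f x df -> is_RCderive (fun y => a * f y) x (a * df).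
Proof.
intros [H1 H2]; split.
- apply is_derive_ext with (fun y => Re a * Re (f y) - Im a * Im (f y))%R.
  { intros y; now rewrite re_mult. }
  rewrite re_mult.
  apply (is_derive_minus (K := R_AbsRing) (V := R_NormedModule)
    (fun y => Re a * Re (f y))%R (fun y => Im a * Im (f y))%R);
    now apply is_derive_scal.
- apply is_derive_ext with (fun y => Re a * Im (f y) + Im a * Re (f y))%R.
  { intros y; now rewrite im_mult. }
  rewrite im_mult.
  apply (is_derive_plus (K := R_AbsRing) (V := R_NormedModule)
    (fun y => Re a * Im (f y))%R (fun y => Im a * Re (f y))%R);
    now apply is_derive_scal.
Qed.

Lemma is_RCderive_csum (F dF : nat -> R -> C) (n : nat) (x : R) :
  (forall k, is_RCderive (F k) x (dF k x)) ->
  is_RCderive (fun y => csum (fun k => F k y) n) x (csum (fun k => dF k x) n).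
Proof.
intros H; induction n as [|n IH].
- rewrite csum_O; apply is_RCderive_ext with (2 := H 0%nat).
  apply filter_forall; intros y; now rewrite csum_O.
- rewrite csum_S; apply is_RCderive_ext with (fun y => csum (fun k => F k y) n + F (S n) y).
  + apply filter_forall; intros y; now rewrite csum_S.
  + now apply is_RCderive_plus.
Qed.

Lemma im_le_Cmod (c : C) : (Rabs (Im c) <= Cmod c)%R.
Proof. eapply Rle_trans; [apply Rmax_r | exact (Rmax_Cmod c)]. Qed.

(** Real and imaginary parts are treated together as a real-linear [g] with [|g c| <= Cmod c]:
    applying [g] to the complex error along real increments can only shrink it. *)
Lemma is_Cderive_RCderive (f : C -> C) (x : R) (l : C) :
  is_Cderive f (RtoC x) l -> is_RCderive (fun y => f (RtoC y)) x l.
Proof.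
intros [_ Hd].
specialize (Hd (RtoC x) (fun P H => H)).
assert (K : forall g : C -> R, (forall c d, g (c - d)%C = g c - g d)%R ->
  (forall (r : R) c, g (RtoC r * c)%C = r * g c)%R ->
  (forall c, Rabs (g c) <= Cmod c)%R ->
  is_derive (fun y => g (f (RtoC y))) x (g l)).
{ intros g Hg1 Hg2 Hg3; split; [apply is_linear_scal_l|].
  intros x' Hx'.
  apply (is_filter_lim_locally_unique (K := R_AbsRing)
    (V := AbsRing_NormedModule R_AbsRing)) in Hx'; subst x'.
  intros eps; destruct (proj1 (near_C _ _) (Hd eps)) as [del Hdel].
  exists del; intros y Hy.
  specialize (Hdel (RtoC y)).
  change (Rabs (y - x) < del)%R in Hy.
  rewrite <- RtoC_minus, Cmod_R in Hdel; specialize (Hdel Hy).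
  change (Cmod (f y - f x - (RtoC y - RtoC x) * l)%C <= eps * Cmod (RtoC y - RtoC x)%C)%R in Hdel.
  change (Rabs ((g (f y) - g (f x)) - (y - x) * g l) <= eps * Rabs (y - x))%R.
  rewrite <- RtoC_minus, Cmod_R in Hdel.
  rewrite <- Hg1, <- Hg2, <- Hg1.
  eapply Rle_trans; [apply Hg3 | exact Hdel]. }
split; apply K.
- intros; unfold Cminus; rewrite re_plus, re_opp; ring.
- intros; apply re_scal_l.
- apply re_le_Cmod.
- intros; unfold Cminus; rewrite im_plus, im_opp; ring.
- intros; apply im_scal_l.
- apply im_le_Cmod.
Qed.

Definition Clog_moment (f : R -> C) (v : C) : Prop :=
  log_moment (fun x => Re (f x)) (Re v) /\ log_moment (fun x => Im (f x)) (Im v).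

Lemma Clog_moment_intro (P Q f : R -> C) :
  (forall x, (0 <= x <= 1)%R ->
     is_RCderive P x (Q x) /\ is_RCderive (fun y => RtoC y * Q y) x (f x)) ->
  Clog_moment f (P 0%R - P 1%R).
Proof.
intros H; split.
- exists (fun x => Re (P x)), (fun x => Re (Q x)); split.
  + intros x Hx; destruct (H x Hx) as [[H1 _] [H2 _]]; split; [exact H1|].
    apply is_derive_ext with (2 := H2); intros y; apply re_scal_l.
  + unfold Cminus; now rewrite re_plus, re_opp.
- exists (fun x => Im (P x)), (fun x => Im (Q x)); split.
  + intros x Hx; destruct (H x Hx) as [[_ H1] [_ H2]]; split; [exact H1|].
    apply is_derive_ext with (2 := H2); intros y; apply im_scal_l.
  + unfold Cminus; now rewrite im_plus, im_opp.
Qed.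

Lemma Clog_moment_ext (f g : R -> C) (v : C) :
  (forall x, (0 <= x <= 1)%R -> f x = g x) -> Clog_moment f v -> Clog_moment g v.
Proof.
intros E [H1 H2]; split.
- apply log_moment_ext with (2 := H1); intros x Hx; now rewrite E.
- apply log_moment_ext with (2 := H2); intros x Hx; now rewrite E.
Qed.

Lemma Clog_moment_plus (f g : R -> C) (u v : C) :
  Clog_moment f u -> Clog_moment g v -> Clog_moment (fun x => f x + g x) (u + v).
Proof.
intros [H1 H2] [H3 H4]; split.
- exact (log_moment_plus _ _ _ _ H1 H3).
- exact (log_moment_plus _ _ _ _ H2 H4).
Qed.

Lemma Clog_moment_scal (a : C) (f : R -> C) (v : C) :
  Clog_moment f v -> Clog_moment (fun x => a * f x) (a * v).
Proof.
intros [H1 H2]; split.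
- rewrite re_mult; apply log_moment_ext with
    (fun x => Re a * Re (f x) - Im a * Im (f x))%R; [intros; now rewrite re_mult|].
  now apply log_moment_minus; apply log_moment_scal.
- rewrite im_mult; apply log_moment_ext with
    (fun x => Re a * Im (f x) + Im a * Re (f x))%R; [intros; now rewrite im_mult|].
  now apply log_moment_plus; apply log_moment_scal.
Qed.

Lemma Clog_moment_csum (F : nat -> R -> C) (v : nat -> C) (n : nat) :
  (forall k, (k <= n)%nat -> Clog_moment (F k) (v k)) ->
  Clog_moment (fun x => csum (fun k => F k x) n) (csum v n).
Proof.
intros H; induction n as [|n IH].
- rewrite csum_O; apply Clog_moment_ext with (F 0%nat); [|now apply H].
  intros; now rewrite csum_O.
- rewrite csum_S; apply Clog_moment_ext with (fun x => csum (fun k => F k x) n + F (S n) x).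
  + intros; now rewrite csum_S.
  + apply Clog_moment_plus; [apply IH; intros; apply H; lia | now apply H].
Qed.

(** The imaginary part of [v] is a moment of the zero function, hence 0 by [log_moment_bound]. *)
Lemma Clog_moment_real (f : R -> R) (v : C) :
  Clog_moment (fun x => RtoC (f x)) v -> log_moment f (Re v) /\ v = RtoC (Re v).
Proof.
intros [H1 H2]; split.
- apply log_moment_ext with (2 := H1); intros; apply re_RtoC.
- pose proof (log_moment_bound _ _ 0 H2) as H.
  destruct v as [a b]; apply injective_projections; [reflexivity|].
  simpl in *; apply Rabs_eq_0, Rle_antisym; [apply H | apply Rabs_pos].
  intros x _; rewrite Rabs_R0; lra.
Qed.

(** * The principal logarithm off its cut, and poles of order at least two *)

Definition off_segment (lam : C) : Prop :=
  forall x : R, (0 <= x <= 1)%R -> RtoC x <> lam.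

(** Half-angle formula [tan (arg / 2) = v / (s + u)], with [s] the modulus. Unlike the definition by
    [acos], it has no case split at [v = 0] and can be differentiated there; [s + u > 0] says that
    the point is off the cut [(-oo, 0]]. *)
Lemma Carg_atan (u v : R) : (0 < sqrt (u ^ 2 + v ^ 2) + u)%R ->
  Carg (u, v) = (2 * atan (v / (sqrt (u ^ 2 + v ^ 2) + u)))%R.
Proof.
intros Hpos; unfold Carg, Cmod; simpl Re; simpl Im; simpl fst; simpl snd.
set (s := sqrt (u ^ 2 + v ^ 2)) in *.
assert (Hs2 : (s * s = u ^ 2 + v ^ 2)%R) by (apply sqrt_sqrt; nra).
assert (Hs0 : (0 <= s)%R) by apply sqrt_pos.
assert (Hs : (0 < s)%R).
{ destruct Hs0 as [Hs0|Hs0]; [exact Hs0|].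
  rewrite <- Hs0 in *; assert (u = 0)%R by nra; lra. }
set (t := (v / (s + u))%R).
assert (Hv : (v = t * (s + u))%R) by (unfold t; field; lra).
(* Equivalently [1 + t^2 = 2 s / (s + u)], whence [cos (2 atan t) = (1 - t^2) / (1 + t^2) = u /
   s]. *)
assert (Ht2 : ((1 + t ^ 2) * (s + u) = 2 * s)%R).
{ apply Rmult_eq_reg_r with (s + u)%R; [|lra].
  transitivity ((s + u) ^ 2 + v ^ 2)%R; [rewrite Hv; ring|].
  replace (v ^ 2)%R with (s * s - u ^ 2)%R by lra; ring. }
assert (Hc : (cos (2 * atan t) = u / s)%R).
{ rewrite cos_2a, cos_atan, sin_atan.
  assert (H1t : (0 < 1 + t²)%R) by (unfold Rsqr; nra).
  pose proof (sqrt_lt_R0 _ H1t) as Hq.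
  replace (1 / sqrt (1 + t²) * (1 / sqrt (1 + t²)) - t / sqrt (1 + t²) * (t / sqrt (1 + t²)))%R
    with ((1 - t ^ 2) / (sqrt (1 + t²) * sqrt (1 + t²)))%R by (field; lra).
  rewrite sqrt_sqrt by lra.
  unfold Rsqr; apply Rmult_eq_reg_r with ((1 + t * t) * (s * (s + u)))%R; [|nra].
  transitivity ((1 - t ^ 2) * (s + u) * s)%R; [field; nra|].
  transitivity (u * ((1 + t ^ 2) * (s + u)))%R; [|field; lra].
  rewrite Ht2; replace ((1 - t ^ 2) * (s + u))%R with (2 * (s + u) - (1 + t ^ 2) * (s + u))%R
    by ring.
  rewrite Ht2; ring. }
pose proof (atan_bound t) as Hb.
rewrite <- Hc.
destruct (Rlt_dec v 0) as [Hneg|Hnn].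
- assert (t < 0)%R by nra.
  assert (atan t < 0)%R by (rewrite <- atan_0; now apply atan_increasing).
  rewrite <- cos_neg, acos_cos; [ring | lra].
- assert (0 <= t)%R by (unfold t; apply Rdiv_le_0_compat; lra).
  assert (0 <= atan t)%R.
  { rewrite <- atan_0; destruct H as [H|<-]; [left; now apply atan_increasing | lra]. }
  rewrite acos_cos; [reflexivity | lra].
Qed.

(** The derivatives of [ln s] and of the half-angle form of the argument are the two components of
    [w' / w] for [w = u + i v]. *)
Lemma is_derive_Cln_arc (u v : R -> R) (x du dv : R) :
  is_derive u x du -> is_derive v x dv ->
  (0 < sqrt (u x ^ 2 + v x ^ 2) + u x)%R ->
  is_RCderive (fun y => Cln (u y, v y)) x ((du, dv) / (u x, v x)).
Proof.
intros Hu Hv Hpos.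
set (s := fun y => sqrt (u y ^ 2 + v y ^ 2)).
assert (Hs2 : (s x * s x = u x ^ 2 + v x ^ 2)%R) by (apply sqrt_sqrt; nra).
assert (Hs0 : (0 <= s x)%R) by apply sqrt_pos.
change (0 < s x + u x)%R in Hpos.
assert (Hs : (0 < s x)%R).
{ destruct Hs0 as [Hs0|Hs0]; [exact Hs0|].
  assert (u x = 0)%R by nra; lra. }
assert (Hr : (0 < u x ^ 2 + v x ^ 2)%R) by nra.
assert (Ds : is_derive s x ((u x * du + v x * dv) / s x)%R).
{ unfold s; auto_derive.
  - split; [eexists; exact Hu | split; [eexists; exact Hv | split; [|exact I]]].
    simpl in Hr; lra.
  - change (fun x => u x) with u; change (fun x => v x) with v.
    rewrite (is_derive_unique _ _ _ Hu), (is_derive_unique _ _ _ Hv).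
    change (sqrt _) with (s x); field; lra. }
assert (Hdiv : (du, dv) / (u x, v x) =
  (((u x * du + v x * dv) / (u x ^ 2 + v x ^ 2))%R,
   ((u x * dv - v x * du) / (u x ^ 2 + v x ^ 2))%R)).
{ unfold Cdiv, Cmult, Cinv; simpl; f_equal; field; simpl in Hr; lra. }
rewrite Hdiv; split.
- change (is_derive (fun y => ln (s y)) x ((u x * du + v x * dv) / (u x ^ 2 + v x ^ 2))%R).
  apply is_derive_Reals.
  replace ((u x * du + v x * dv) / (u x ^ 2 + v x ^ 2))%R with
    (/ s x * ((u x * du + v x * dv) / s x))%R.
  2:{ rewrite <- Hs2; field; lra. }
  apply (derivable_pt_lim_comp s ln); [exact (proj1 (is_derive_Reals _ _ _) Ds)|].
  now apply derivable_pt_lim_ln.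
- assert (Dt : is_derive (fun y => 2 * atan (v y / (s y + u y)))%R x
    ((u x * dv - v x * du) / (u x ^ 2 + v x ^ 2))%R).
  { auto_derive.
    - split; [eexists; exact Hv | split; [eexists; exact Ds | split; [eexists; exact Hu|]]].
      split; [lra | exact I].
    - change (fun x => s x) with s; change (fun x => u x) with u; change (fun x => v x) with v.
      rewrite (is_derive_unique _ _ _ Hu), (is_derive_unique _ _ _ Hv),
        (is_derive_unique _ _ _ Ds).
      assert (Hv2 : (v x ^ 2 = s x * s x - u x ^ 2)%R) by lra.
      rewrite <- Hs2.
      set (S := s x) in *; set (U := u x) in *; set (V := v x) in *.
      assert (E : (S ^ 2 + 2 * S * U + U ^ 2 + V ^ 2 = 2 * S * (S + U))%R)
        by (rewrite Hv2; ring).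
      assert (E1 : (1 + V / (S + U) * (V / (S + U)) = 2 * S / (S + U))%R).
      { transitivity ((S ^ 2 + 2 * S * U + U ^ 2 + V ^ 2) / (S + U) ^ 2)%R;
          [field; lra|]. rewrite E; field; lra. }
      rewrite ?Rmult_1_r; change (V * / (S + U))%R with (V / (S + U))%R; rewrite E1.
      apply Rmult_eq_reg_r with (S * S * (S + U))%R; [|nra].
      transitivity ((dv * S * (S + U) - V * (U * du + V * dv + S * du)))%R;
        [field; lra|].
      transitivity ((U * dv - V * du) * (S + U))%R; [|field; lra].
      replace (V * (U * du + V * dv + S * du))%R with
        (V * U * du + V ^ 2 * dv + V * S * du)%R by ring.
      rewrite Hv2; ring. }
  apply is_derive_ext_loc with (2 := Dt).
  (* [s + u] stays positive near [x], so the half-angle form agrees with [Carg] on a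
     neighbourhood. *)
  assert (Hc : continuous (fun y => s y + u y)%R x).
  { apply (continuous_plus (V := R_NormedModule) s u);
      apply (ex_derive_continuous (K := R_AbsRing) (V := R_NormedModule));
      eexists; eassumption. }
  specialize (Hc _ (open_gt 0%R _ Hpos)); revert Hc; unfold filtermap.
  apply filter_imp; intros y Hy.
  symmetry; exact (Carg_atan (u y) (v y) Hy).
Qed.

Lemma off_segment_neq (lam : C) (x : R) : off_segment lam -> (0 <= x <= 1)%R ->
  RtoC x - lam <> 0.
Proof. intros H Hx; now apply Cminus_eq_contra, H. Qed.

Lemma off_segment_neq_0 (lam : C) : off_segment lam -> lam <> 0.
Proof. intros H E; apply (H 0%R); [lra | now rewrite E]. Qed.

(** If [t / lam] were a real [r >= 1], then [lam = t / r] would lie in [[0,1]]. This keeps the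
    segment from 0 to [1 / lam] off the cut of the dilogarithm, and [1 - t / lam] off that of the
    logarithm. *)
Lemma inv_off_segment (lam : C) (t : R) : off_segment lam -> (0 <= t <= 1)%R ->
  ~ (Im (RtoC t * / lam) = 0%R /\ (1 <= Re (RtoC t * / lam))%R).
Proof.
intros Hlam Ht [HI HR].
pose proof (off_segment_neq_0 _ Hlam) as Hl0.
set (r := Re (RtoC t * / lam)) in *.
assert (E : RtoC t * / lam = RtoC r)
  by (apply injective_projections; [reflexivity | exact HI]).
apply (Hlam (t / r)%R).
- split; [apply Rdiv_le_0_compat; lra|].
  apply Rle_div_l; lra.
- rewrite RtoC_div, <- E by lra; field; split; [exact Hl0|].
  intros E'; apply RtoC_inj in E'; subst t.
  assert (r = 0)%R by (apply RtoC_inj; rewrite <- E; ring); lra.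
Qed.

(** The argument is [1 - y / lam] because [y - lam] itself would run along the cut for real
    [lam > 1]; both have logarithmic derivative [1 / (y - lam)]. *)
Lemma is_RCderive_Cln_arc (lam : C) (x : R) : off_segment lam -> (0 <= x <= 1)%R ->
  is_RCderive (fun y => Cln (1 - RtoC y * / lam)) x (/ (RtoC x - lam)).
Proof.
intros Hlam Hx.
pose proof (off_segment_neq_0 _ Hlam) as Hl0.
pose proof (off_segment_neq _ _ Hlam Hx) as Hxl.
pose proof (inv_off_segment _ x Hlam Hx) as Hs.
destruct (/ lam) as [a b] eqn:Hw.
assert (E : forall y : R, 1 - RtoC y * (a, b) = ((1 - y * a)%R, (- (y * b))%R)).
{ intros y; apply injective_projections; simpl; ring. }
apply is_RCderive_ext with (fun y => Cln ((1 - y * a)%R, (- (y * b))%R)).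
{ apply filter_forall; intros y; now rewrite E. }
replace (/ (RtoC x - lam)) with (((- a)%R, (- b)%R) / ((1 - x * a)%R, (- (x * b))%R)).
- apply (is_derive_Cln_arc (fun y => 1 - y * a)%R (fun y => - (y * b))%R);
    [auto_derive; [exact I | ring] | auto_derive; [exact I | ring] |].
  rewrite re_mult, im_mult, re_RtoC, im_RtoC in Hs; simpl in Hs.
  set (u := (1 - x * a)%R); set (v := (- (x * b))%R).
  (* [|u| <= s] gives [s + u > 0] unless [u <= 0] and [v = 0], and in that case [x / lam] would be
     real and at least 1. *)
  assert (Hn : (Rabs u <= sqrt (u ^ 2 + v ^ 2))%R).
  { rewrite <- sqrt_Rsqr_abs; apply sqrt_le_1_alt; unfold Rsqr; nra. }
  destruct (Rlt_le_dec 0 u) as [Hu|Hu].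
  { pose proof (Rabs_pos u); lra. }
  rewrite Rabs_left1 in Hn by exact Hu.
  destruct Hn as [Hn|Hn]; [lra|]; exfalso; apply Hs.
  assert (Hss : (u ^ 2 + v ^ 2 = u ^ 2)%R).
  { rewrite <- (sqrt_sqrt (u ^ 2 + v ^ 2)) by nra; rewrite <- Hn; ring. }
  unfold u, v in *; split; nra.
- rewrite <- E, <- Hw.
  replace ((- a)%R, (- b)%R) with (- / lam).
  + field; repeat split; try assumption.
    intros E'; apply Hxl.
    replace (RtoC x - lam) with (- (lam - RtoC x)) by ring; rewrite E'; ring.
  + rewrite Hw; reflexivity.
Qed.

Lemma geom_sum_diff (A B : C) (n : nat) :
  (A - B) * csum (fun q => A ^ q * B ^ (n - q)) n = A ^ S n - B ^ S n.
Proof.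
induction n as [|n IH]; [rewrite csum_O; simpl; ring|].
rewrite csum_S, Nat.sub_diag, (csum_ext _ (fun q => B * (A ^ q * B ^ (n - q)))).
- rewrite csum_mult_l.
  transitivity (B * ((A - B) * csum (fun q => A ^ q * B ^ (n - q)) n) + (A - B) * A ^ S n).
  + simpl; ring.
  + rewrite IH; simpl; ring.
- intros k Hk; replace (S n - k)%nat with (S (n - k)) by lia; simpl; ring.
Qed.

Lemma is_Cderive_inv_pow (mu x : C) (n : nat) : x <> mu ->
  is_Cderive (fun y => (/ (y - mu)) ^ S n) x (- (RtoC (INR (S n)) * (/ (x - mu)) ^ S (S n))).
Proof.
intros H; induction n as [|n IH].
- replace (- (RtoC (INR 1) * (/ (x - mu)) ^ 2)) with (- (/ (x - mu) * / (x - mu)))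
    by (simpl; ring).
  apply is_Cderive_ext with (2 := is_Cderive_inv mu x H).
  apply filter_forall; intros y; simpl; ring.
- replace (- (RtoC (INR (S (S n))) * (/ (x - mu)) ^ S (S (S n)))) with
    (- (/ (x - mu) * / (x - mu)) * (/ (x - mu)) ^ S n +
     / (x - mu) * - (RtoC (INR (S n)) * (/ (x - mu)) ^ S (S n))).
  + apply (is_Cderive_mult (fun y => / (y - mu))); [now apply is_Cderive_inv | exact IH].
  + rewrite (S_INR (S n)), RtoC_plus; simpl Cpow; ring.
Qed.

Lemma INR_S_neq_0 (n : nat) : RtoC (INR (S n)) <> 0.
Proof. intros E; apply RtoC_inj in E; revert E; apply not_0_INR; lia. Qed.

Lemma Cln_1 : Cln 1 = 0.
Proof.
assert (E : Carg 1 = 0%R).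
{ unfold Carg; rewrite Cmod_1; simpl; destruct (Rlt_dec 0 0); [lra|].
  replace (1 / 1)%R with 1%R by field; apply acos_1. }
unfold Cln; now rewrite Cmod_1, ln_1, E.
Qed.

Lemma Clog_moment_pole (Li2 : C -> C) (lam : C) (n : nat) : off_segment lam ->
  Clog_moment (fun x => / (RtoC x - lam) ^ S (S n)) (C_coef Li2 (S n) lam).
Proof.
intros Hlam.
pose proof (off_segment_neq_0 _ Hlam) as Hl0.
pose proof (INR_S_neq_0 n) as Hn.
(* [x * Q x = - ((x - lam)^-(n+1) - (- lam)^-(n+1)) / (n+1)]; the division by [x]
   is carried out by [geom_sum_diff]. *)
set (B := - / lam).
(* [Lq q] is an antiderivative of [(x - lam)^-(q+1)]. Only [q = 0] produces a logarithm, normalised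
   to vanish at [x = 0]; the powers [q >= 1] yield the sum over [p] in [C_coef]. *)
set (Lq := fun q (x : R) => match q with
  | O => Cln (1 - RtoC x * / lam)
  | S q' => - / RtoC (INR q) * (/ (RtoC x - lam)) ^ q
  end).
set (P := fun x => / RtoC (INR (S n)) * csum (fun q => B ^ S (n - q) * Lq q x) n).
set (Q := fun x => / RtoC (INR (S n)) *
  csum (fun q => B ^ S (n - q) * (/ (RtoC x - lam)) ^ S q) n).
replace (C_coef Li2 (S n) lam) with (P 0%R - P 1%R).
- apply (Clog_moment_intro P Q); intros x Hx.
  pose proof (off_segment_neq _ _ Hlam Hx) as Hxl.
  assert (Hxl' : RtoC x <> lam) by now apply Hlam.
  split.
  + apply is_RCderive_scal.
    apply (is_RCderive_csum (fun q y => B ^ S (n - q) * Lq q y)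
      (fun q y => B ^ S (n - q) * (/ (RtoC y - lam)) ^ S q)).
    intros [|q]; apply is_RCderive_scal.
    * rewrite Cpow_1_r; now apply is_RCderive_Cln_arc.
    * unfold Lq.
      replace ((/ (RtoC x - lam)) ^ S (S q)) with
        (- / RtoC (INR (S q)) * (- (RtoC (INR (S q)) * (/ (RtoC x - lam)) ^ S (S q))))
        by (field; apply INR_S_neq_0).
      apply (is_RCderive_scal _ (fun y => (/ (RtoC y - lam)) ^ S q)).
      now apply (is_Cderive_RCderive (fun y => (/ (y - lam)) ^ S q)), is_Cderive_inv_pow.
  + apply is_RCderive_ext with
      (fun y => - / RtoC (INR (S n)) * ((/ (RtoC y - lam)) ^ S n + - B ^ S n)).
    * assert (Hloc : locally x (fun y => RtoC y <> lam)).
      { destruct (proj1 (near_C _ _) (near_neq _ _ Hxl')) as [e He].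
        exists e; intros y Hy; apply He.
        rewrite <- RtoC_minus, Cmod_R; exact Hy. }
      revert Hloc; apply filter_imp; intros y Hy.
      assert (Hyl : RtoC y - lam <> 0) by now apply Cminus_eq_contra.
      unfold Q.
      replace ((/ (RtoC y - lam)) ^ S n + - B ^ S n) with
        ((/ (RtoC y - lam)) ^ S n - B ^ S n) by reflexivity.
      rewrite <- geom_sum_diff.
      replace (/ (RtoC y - lam) - B) with (- (RtoC y * (/ (RtoC y - lam) * B)))
        by (unfold B; field; split; assumption).
      rewrite (csum_ext (fun q => B ^ S (n - q) * (/ (RtoC y - lam)) ^ S q)
        (fun q => (/ (RtoC y - lam) * B) * ((/ (RtoC y - lam)) ^ q * B ^ (n - q))))
        by (intros; simpl; cring).
      rewrite csum_mult_l; ring.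
    * replace (/ (RtoC x - lam) ^ S (S n)) with (- / RtoC (INR (S n)) *
        (- (RtoC (INR (S n)) * (/ (RtoC x - lam)) ^ S (S n)) + 0)).
      2:{ rewrite Cpow_inv by exact Hxl; field.
          split; [now apply (Cpow_nz _ (S (S n))) | exact Hn]. }
      apply is_RCderive_scal, is_RCderive_plus; [|apply is_RCderive_const].
      now apply (is_Cderive_RCderive (fun y => (/ (y - lam)) ^ S n)), is_Cderive_inv_pow.
- unfold P, C_coef.
  replace (S n - 1)%nat with n by lia.
  set (F := fun p => _ * (1 / (lam - 1) ^ p - 1 / lam ^ p)).
  assert (Hl1 : lam - 1 <> 0).
  { apply Cminus_eq_contra; intros E; apply (Hlam 1%R); [lra | now rewrite E]. }
  assert (Hm1 : RtoC 1 - lam <> 0) by (apply (off_segment_neq lam 1 Hlam); lra).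
  assert (Hpm : forall k (c : C), c <> 0 -> (- / c) ^ k = (- (1)) ^ k * / c ^ k).
  { intros k c Hc; replace (- / c) with (- (1) * / c) by ring.
    now rewrite Cpow_mult_l, Cpow_inv. }
  assert (Hsg : forall k, (- (1)) ^ k * (- (1)) ^ k = 1).
  { intros k; rewrite <- Cpow_mult_l; replace (- (1) * - (1)) with (RtoC 1) by ring.
    apply Cpow_1_l. }
  transitivity (/ RtoC (INR (S n)) *
    csum (fun q => B ^ S (n - q) * (Lq q 0%R - Lq q 1%R)) n).
  { rewrite (csum_ext (fun q => B ^ S (n - q) * (Lq q 0%R - Lq q 1%R))
      (fun q => B ^ S (n - q) * Lq q 0%R + (- (1)) * (B ^ S (n - q) * Lq q 1%R)))
      by (intros; cring).
    rewrite csum_plus, csum_mult_l; ring. }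
  assert (E0 : B ^ S (n - 0) * (Lq 0%nat 0%R - Lq 0%nat 1%R) =
    - (- (1)) ^ S n / lam ^ S n * Cln ((lam - 1) / lam)).
  { rewrite Nat.sub_0_r; unfold Lq, B; rewrite Hpm by exact Hl0.
    replace (1 - RtoC 0 * / lam) with (RtoC 1) by ring.
    replace (1 - RtoC 1 * / lam) with ((lam - 1) / lam) by (field; exact Hl0).
    rewrite Cln_1; unfold Cdiv; ring. }
  (* The index [q] is the [p] of [C_coef]: the sign [(-1)^(n+1-q)] of the power of [B] and the
     [(-1)^q] of the endpoint values combine into one that is independent of [q]. *)
  assert (Eq : forall q, (1 <= q <= n)%nat ->
    B ^ S (n - q) * (Lq q 0%R - Lq q 1%R) = (- (1)) ^ S n * F q).
  { intros [|q] Hq; [lia|].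
    unfold Lq, F.
    replace (/ (RtoC 0 - lam)) with (- / lam) by (field; exact Hl0).
    replace (/ (RtoC 1 - lam)) with (- / (lam - 1)) by (field; split; assumption).
    unfold B; rewrite !Hpm by assumption.
    replace (S n - S q)%nat with (n - q)%nat by lia.
    replace (S (n - S q)) with (n - q)%nat by lia.
    replace (S n) with (n - q + S q)%nat by lia; rewrite Cpow_add_r.
    pose proof (INR_S_neq_0 q); pose proof (Cpow_nz _ (n - q) Hl0).
    pose proof (Cpow_nz _ (S q) Hl0); pose proof (Cpow_nz _ (S q) Hl1).
    set (s := (- (1)) ^ S q); set (s' := (- (1)) ^ (n - q)).
    set (X := lam ^ (n - q)) in *; set (Y := lam ^ S q) in *; set (Z := (lam - 1) ^ S q) in *.
    set (r := RtoC (INR (S q))) in *.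
    field; repeat split; assumption. }
  replace (RtoC (-1)) with (- (1)) by (rewrite <- RtoC_opp; reflexivity).
  (* For [n = 0] the sum over [p] is empty and only the logarithm remains. *)
  destruct n as [|n].
  + rewrite csum_O, E0, sum_n_m_zero by lia.
    change (zero (G := C_AbelianMonoid)) with (RtoC 0).
    field; repeat split; try assumption; now apply (Cpow_nz _ 1).
  + rewrite csum_shift, E0.
    rewrite (csum_ext _ (fun k => (- (1)) ^ S (S n) * F (S k))) by (intros; apply Eq; lia).
    rewrite csum_mult_l.
    replace (sum_n_m (G := C_AbelianMonoid) F 1 (S n)) with (csum (fun k => F (S k)) n).
    2:{ unfold sum_n; now rewrite <- sum_n_m_S. }
    pose proof (Cpow_nz _ (S (S n)) Hl0).
    set (X := lam ^ S (S n)) in *; set (s := (- (1)) ^ S (S n)).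
    set (c := csum (fun k => F (S k)) n : C).
    field; split; assumption.
Qed.

(** * Real-analytic functions *)

Open Scope R_scope.

(** [PSeries] has a value even where the series diverges, so the positive radius has to be part of
    the definition. *)
Definition real_analytic (f : R -> R) (t0 : R) : Prop :=
  exists b : nat -> R, Rbar_lt 0 (CV_radius b) /\
    locally t0 (fun t => f t = PSeries b (t - t0)).

Lemma scal_pow_n (x y : R) (n : nat) : scal (pow_n x n) y = x ^ n * y.
Proof. now rewrite pow_n_pow. Qed.

Lemma CV_radius_pos_of_ex (b : nat -> R) (r : R) : 0 < r ->
  ex_pseries b r -> Rbar_lt 0 (CV_radius b).
Proof.
intros Hr Hb; apply Rbar_not_le_lt; intros Hle.
apply (CV_disk_outside b r).
- apply Rbar_le_lt_trans with (1 := Hle); rewrite Rabs_pos_eq; simpl; lra.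
- apply ex_series_lim_0 in Hb; revert Hb; apply is_lim_seq_ext; intros n.
  rewrite scal_pow_n; ring.
Qed.

Lemma CV_radius_near (b : nat -> R) (t0 : R) : Rbar_lt 0 (CV_radius b) ->
  locally t0 (fun t => Rbar_lt (Rabs (t - t0)) (CV_radius b)).
Proof.
destruct (CV_radius b) as [r| |] eqn:E; simpl; intros H; try easy.
- exists (mkposreal r H); intros t Ht; exact Ht.
- apply filter_forall; easy.
Qed.

Lemma real_analytic_affine (c d t0 : R) : real_analytic (fun t => c + d * t) t0.
Proof.
set (b := fun n => match n with O => c + d * t0 | 1%nat => d | _ => 0 end).
assert (Hdd : forall n, PS_decr_1 (PS_decr_1 b) n = 0) by reflexivity.
assert (Hr : Rbar_lt 0 (CV_radius b)).
{ rewrite <- CV_radius_decr_1, <- CV_radius_decr_1, (CV_radius_ext _ _ Hdd),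
    CV_radius_const_0; exact I. }
exists b; split; [exact Hr|].
generalize (CV_radius_near b t0 Hr); apply filter_imp; intros t Ht.
rewrite PSeries_decr_1 by now apply CV_radius_inside.
rewrite PSeries_decr_1 by (apply CV_radius_inside; now rewrite CV_radius_decr_1).
rewrite (PSeries_ext _ _ _ Hdd), PSeries_const_0.
unfold PS_decr_1; simpl; ring.
Qed.

Lemma real_analytic_ext (f g : R -> R) (t0 : R) :
  (forall t, f t = g t) -> real_analytic f t0 -> real_analytic g t0.
Proof.
intros E [b [Hb Hf]]; exists b; split; [exact Hb|].
revert Hf; apply filter_imp; intros t <-; now rewrite E.
Qed.

Lemma real_analytic_plus (f g : R -> R) (t0 : R) :
  real_analytic f t0 -> real_analytic g t0 -> real_analytic (fun t => f t + g t) t0.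
Proof.
intros [b [Hb Hf]] [c [Hc Hg]]; exists (PS_plus b c); split.
- apply Rbar_lt_le_trans with (2 := CV_radius_plus b c).
  now apply Rbar_min_case.
- pose proof (CV_radius_near b t0 Hb) as Nb; pose proof (CV_radius_near c t0 Hc) as Nc.
  generalize (filter_and _ _ (filter_and _ _ Hf Hg) (filter_and _ _ Nb Nc)).
  apply filter_imp; intros t [[-> ->] [H1 H2]].
  rewrite PSeries_plus; [reflexivity | |]; now apply CV_radius_inside.
Qed.

Lemma real_analytic_mult (f g : R -> R) (t0 : R) :
  real_analytic f t0 -> real_analytic g t0 -> real_analytic (fun t => f t * g t) t0.
Proof.
intros [b [Hb Hf]] [c [Hc Hg]]; exists (PS_mult b c).
pose proof (CV_radius_near b t0 Hb) as Nb; pose proof (CV_radius_near c t0 Hc) as Nc.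
split.
(* The radius of the Cauchy product is positive because the product converges at [e / 2], a point
   inside both disks of convergence. *)
- destruct (filter_and _ _ Nb Nc) as [e He].
  assert (He2 : 0 < e / 2) by (pose proof (cond_pos e); lra).
  destruct (He (t0 + e / 2)) as [H1 H2].
  { change (Rabs (t0 + e / 2 - t0) < e).
    replace (t0 + e / 2 - t0) with (e / 2) by ring; rewrite Rabs_pos_eq; lra. }
  replace (t0 + e / 2 - t0) with (e / 2) in * by ring.
  apply CV_radius_pos_of_ex with (e / 2); [exact He2 | now apply ex_pseries_mult].
- generalize (filter_and _ _ (filter_and _ _ Hf Hg) (filter_and _ _ Nb Nc)).
  apply filter_imp; intros t [[-> ->] [H1 H2]].
  now rewrite PSeries_mult.
Qed.

Lemma is_derive_PSeries_shift (b : nat -> R) (t0 t : R) :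
  Rbar_lt (Rabs (t - t0)) (CV_radius b) ->
  is_derive (fun t => PSeries b (t - t0)) t (PSeries (PS_derive b) (t - t0)).
Proof.
intros H.
replace (PSeries (PS_derive b) (t - t0)) with
  (scal (1 : R_AbsRing) (PSeries (PS_derive b) (t - t0)))
  by (unfold scal; simpl; unfold mult; simpl; ring).
apply (is_derive_comp (PSeries b) (fun t => t - t0)).
- now apply is_derive_PSeries.
- auto_derive; [exact I | ring].
Qed.

Lemma real_analytic_is_derive (f : R -> R) (t0 : R) :
  real_analytic f t0 -> locally t0 (fun t => is_derive f t (Derive f t)).
Proof.
intros [b [Hb Hf]].
generalize (filter_and _ _ (locally_locally _ _ Hf) (CV_radius_near b t0 Hb)).
apply filter_imp; intros t [Ht Hr]; apply Derive_correct.
exists (PSeries (PS_derive b) (t - t0)).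
apply is_derive_ext_loc with (2 := is_derive_PSeries_shift b t0 t Hr).
revert Ht; apply filter_imp; now intros y ->.
Qed.

Lemma PSeries_Derive_near (b : nat -> R) (f : R -> R) (t0 : R) :
  Rbar_lt 0 (CV_radius b) -> locally t0 (fun t => f t = PSeries b (t - t0)) ->
  locally t0 (fun t => Derive f t = PSeries (PS_derive b) (t - t0)).
Proof.
intros Hb Hf.
generalize (filter_and _ _ (locally_locally _ _ Hf) (CV_radius_near b t0 Hb)).
apply filter_imp; intros t [Ht Hr]; apply is_derive_unique.
apply is_derive_ext_loc with (2 := is_derive_PSeries_shift b t0 t Hr).
revert Ht; apply filter_imp; now intros y ->.
Qed.

Lemma real_analytic_Derive (f : R -> R) (t0 : R) :
  real_analytic f t0 -> real_analytic (Derive f) t0.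
Proof.
intros [b [Hb Hf]]; exists (PS_derive b); split; [now rewrite CV_radius_derive|].
now apply PSeries_Derive_near.
Qed.

(** Continuity at 0 forces [b 0 = 0]; dividing by [s <> 0] then gives the same situation for the
    shifted series. Vanishing is assumed on the left only, as this is all that is known at a
    supremum. *)
Lemma PSeries_zero_left (b : nat -> R) (e : R) :
  Rbar_lt 0 (CV_radius b) -> 0 < e ->
  (forall s, - e < s < 0 -> PSeries b s = 0) -> forall n, b n = 0.
Proof.
intros Hb He Hz n; revert b Hb Hz; induction n as [|n IH]; intros b Hb Hz;
  assert (H0 : b 0%nat = 0).
1,3: destruct (Req_dec (b 0%nat) 0) as [|Hne]; [assumption|]; exfalso;
  assert (Hc : continuity_pt (PSeries b) 0) by
    (apply PSeries_continuity; now rewrite Rabs_R0);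
  destruct (Hc (Rabs (b 0%nat)) (Rabs_pos_lt _ Hne)) as [d [Hd Hlim]];
  assert (Hm : 0 < Rmin d e / 2) by (pose proof (Rmin_pos d e Hd He); lra);
  pose proof (Rmin_l d e); pose proof (Rmin_r d e);
  assert (Hs : R_dist (PSeries b (- (Rmin d e / 2))) (PSeries b 0) < Rabs (b 0%nat))
    by (apply Hlim; split; [split; [exact I | lra] |];
        simpl; unfold R_dist; rewrite Rminus_0_r, Rabs_Ropp, Rabs_pos_eq; lra);
  rewrite Hz, PSeries_0 in Hs by lra; unfold R_dist in Hs;
  rewrite Rminus_0_l, Rabs_Ropp in Hs; lra.
- exact H0.
- apply (IH (PS_decr_1 b)); [now rewrite CV_radius_decr_1|].
  intros s Hs; apply Rmult_eq_reg_l with s; [|lra].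
  rewrite Rmult_0_r, <- PSeries_decr_1_aux by exact H0; now apply Hz.
Qed.

Lemma real_analytic_zero_left (f : R -> R) (t0 e : R) : 0 < e ->
  real_analytic f t0 -> (forall t, t0 - e < t < t0 -> f t = 0) ->
  locally t0 (fun t => f t = 0).
Proof.
intros He [b [Hb [d Hd]]] Hz.
assert (Hb0 : forall n, b n = 0).
{ apply PSeries_zero_left with (Rmin e d);
    [exact Hb | apply Rmin_pos; [lra | apply cond_pos]|].
  intros s Hs; pose proof (Rmin_l e d); pose proof (Rmin_r e d).
  transitivity (f (t0 + s)).
  - rewrite Hd; [f_equal; ring|].
    change (Rabs (t0 + s - t0) < d); replace (t0 + s - t0) with s by ring.
    rewrite Rabs_left; lra.
  - apply Hz; lra. }
exists d; intros t Ht; rewrite Hd by exact Ht.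
rewrite (PSeries_ext _ (fun _ => 0)) by exact Hb0; apply PSeries_const_0.
Qed.

(** Let [s] be the supremum of the [x] with [f = 0] on [[0, x]]. One-sided vanishing at [s], or the
    assumption near 0 if [s = 0], spreads to a full neighbourhood of [s]. *)
Lemma real_analytic_identity (f : R -> R) (T : R) : 0 <= T ->
  (forall t, 0 <= t <= T -> real_analytic f t) ->
  locally 0 (fun t => f t = 0) ->
  forall t, 0 <= t <= T -> f t = 0.
Proof.
intros HT Hf H0.
set (E := fun x => 0 <= x <= T /\ forall t, 0 <= t <= x -> f t = 0).
assert (HE0 : E 0).
{ split; [lra|]; intros t Ht; replace t with 0 by lra.
  exact (locally_singleton _ _ H0). }
destruct (completeness E) as [s [Hub Hlub]].
{ exists T; intros x [Hx _]; lra. }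
{ now exists 0. }
assert (Hs0 : 0 <= s) by now apply Hub.
assert (HsT : s <= T) by (apply Hlub; intros x [Hx _]; lra).
assert (Hz : forall t, 0 <= t < s -> f t = 0).
{ intros t Ht; destruct (Req_dec (f t) 0) as [|Hne]; [assumption|]; exfalso.
  assert (s <= t); [|lra].
  apply Hlub; intros x [Hx Hx']; destruct (Rle_lt_dec x t); [assumption|].
  exfalso; apply Hne, Hx'; lra. }
assert (Hloc : locally s (fun t => f t = 0)).
{ destruct Hs0 as [Hs0|<-]; [|exact H0].
  apply real_analytic_zero_left with s; [exact Hs0 | apply Hf; lra|].
  intros t Ht; apply Hz; lra. }
destruct Hloc as [d Hd].
(* This point lies in [E], so it cannot exceed [s]; hence the minimum is [T]. *)
set (s' := Rmin T (s + d / 2)).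
pose proof (cond_pos d).
assert (Hs' : E s').
{ unfold s'; split; [split; [apply Rmin_glb; lra | apply Rmin_l]|].
  intros t Ht; pose proof (Rmin_r T (s + d / 2)).
  destruct (Rlt_le_dec t s) as [Hlt|Hge]; [apply Hz; lra|].
  apply Hd; change (Rabs (t - s) < d); rewrite Rabs_pos_eq; lra. }
pose proof (Hub _ Hs') as Hle.
assert (s' = T).
{ unfold s' in *; revert Hle; apply Rmin_case_strong; lra. }
intros t Ht; destruct Hs' as [_ Hs']; apply Hs'; lra.
Qed.

(** * The dilogarithm along a ray *)

Open Scope C_scope.

Lemma is_series_Re_Im (u : nat -> C) (l : C) :
  is_series (K := C_AbsRing) (V := C_NormedModule) u l ->
  is_series (fun k => Re (u k)) (Re l) /\ is_series (fun k => Im (u k)) (Im l).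
Proof.
intros H.
assert (HR : forall n, sum_n (fun k => Re (u k)) n = Re (sum_n (G := C_NormedModule) u n)).
{ induction n as [|n IH]; [now rewrite !sum_O|]; now rewrite !sum_Sn, IH. }
assert (HI : forall n, sum_n (fun k => Im (u k)) n = Im (sum_n (G := C_NormedModule) u n)).
{ induction n as [|n IH]; [now rewrite !sum_O|]; now rewrite !sum_Sn, IH. }
split; intros P [e He]; unfold filtermap.
- assert (HP : locally (T := C_UniformSpace) l (fun c => P (Re c))).
  { exists e; intros y [Hy _]; apply He; exact Hy. }
  specialize (H _ HP); revert H; unfold filtermap; apply filter_imp; intros n; now rewrite HR.
- assert (HP : locally (T := C_UniformSpace) l (fun c => P (Im c))).
  { exists e; intros y [_ Hy]; apply He; exact Hy. }
  specialize (H _ HP); revert H; unfold filtermap; apply filter_imp; intros n; now rewrite HI.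
Qed.

Lemma Cpow_n (c : C) (n : nat) : pow_n (K := C_AbsRing) c n = c ^ n.
Proof. induction n as [|n IH]; [reflexivity|]; simpl; now rewrite IH. Qed.

(** Substituting [w = t W] replaces the coefficient [a n] by [W^n a n] and the radius [e] by
    [e / |W|]; for real [t - t0] the real and imaginary parts separate. *)
Lemma analytic_at_ray (L : C -> C) (W : C) (t0 : R) : W <> 0 ->
  analytic_at L (RtoC t0 * W) ->
  real_analytic (fun t => Re (L (RtoC t * W))) t0 /\
  real_analytic (fun t => Im (L (RtoC t * W))) t0.
Proof.
intros HW [a [e Ha]].
assert (HmW : (0 < Cmod W)%R) by now apply Cmod_gt_0.
assert (He : (0 < e / Cmod W)%R) by (apply Rdiv_lt_0_compat; [apply cond_pos | exact HmW]).
set (d := mkposreal _ He).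
assert (H : forall t : R, (Rabs (t - t0) < d)%R ->
  is_pseries (fun n => Re (W ^ n * a n)) (t - t0)%R (Re (L (RtoC t * W))) /\
  is_pseries (fun n => Im (W ^ n * a n)) (t - t0)%R (Im (L (RtoC t * W)))).
{ intros t Ht; simpl in Ht.
  assert (E : RtoC t * W - RtoC t0 * W = RtoC (t - t0) * W) by (rewrite RtoC_minus; ring).
  specialize (Ha (RtoC t * W)); rewrite E, Cmod_mult, Cmod_R in Ha.
  apply Rlt_div_r in Ht; [|exact HmW].
  destruct (is_series_Re_Im _ _ (Ha Ht)) as [H1 H2].
  assert (Hk : forall k, scal (pow_n (K := C_AbsRing) (RtoC (t - t0) * W) k) (a k) =
    RtoC ((t - t0) ^ k) * (W ^ k * a k)).
  { intros k; rewrite Cpow_n, Cpow_mult_l, <- RtoC_pow.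
    transitivity (RtoC ((t - t0) ^ k) * W ^ k * a k); [reflexivity | cring]. }
  split.
  - apply is_series_ext with (2 := H1); intros k; rewrite Hk, re_scal_l.
    symmetry; apply scal_pow_n.
  - apply is_series_ext with (2 := H2); intros k; rewrite Hk, im_scal_l.
    symmetry; apply scal_pow_n. }
assert (K : forall (b : nat -> R) (f : R -> R),
  (forall t, (Rabs (t - t0) < d)%R -> is_pseries b (t - t0)%R (f t)) -> real_analytic f t0).
{ intros b f Hf; exists b; split.
  - apply CV_radius_pos_of_ex with (d / 2)%R; [pose proof (cond_pos d); lra|].
    exists (f (t0 + d / 2)%R).
    specialize (Hf (t0 + d / 2)%R).
    replace (t0 + d / 2 - t0)%R with (d / 2)%R in Hf by ring; apply Hf.
    pose proof (cond_pos d); rewrite Rabs_pos_eq; lra.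
  - exists d; intros t Ht; symmetry; now apply is_pseries_unique, Hf. }
split; [apply K with (1 := fun t Ht => proj1 (H t Ht))
      | apply K with (1 := fun t Ht => proj2 (H t Ht))].
Qed.

(* Undoes the weights [1/k^2] of the dilogarithm series: [t^k] is sent to
   [k^2 * t^(k-1)]. *)
Definition derive_t_derive (f : R -> R) : R -> R := Derive (fun t => t * Derive f t)%R.

(* The real and imaginary parts of [(1 - t W) * (U + i V) = W], where [U + i V]
   is [derive_t_derive] of [t |-> L (t W)]. *)
Lemma dilog_ray_ode (L : C -> C) (W : C) : is_dilogarithm L -> W <> 0 ->
  let p (t : R) := Re (L (RtoC t * W)) in
  let q (t : R) := Im (L (RtoC t * W)) in
  locally 0%R (fun t =>
    (derive_t_derive p t = Re W + t * (Re W * derive_t_derive p t - Im W * derive_t_derive q t) /\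
     derive_t_derive q t = Im W + t * (Re W * derive_t_derive q t + Im W * derive_t_derive p t))%R).
Proof.
intros HL HW0 p q.
assert (HmW : (0 < Cmod W)%R) by now apply Cmod_gt_0.
assert (Hd : (0 < / Cmod W)%R) by now apply Rinv_0_lt_compat.
set (d := mkposreal _ Hd).
(* The dilogarithm series is indexed from the power 1, hence the explicit coefficient 0 at
   [n = 0]. *)
set (c := fun (g : C -> R) n => match n with
  | O => 0%R | S _ => (g (W ^ n)%C / INR n ^ 2)%R end).
assert (Hc : forall g : C -> R, (g = Re \/ g = Im) ->
  forall t, (Rabs (t - 0) < d)%R -> is_pseries (c g) (t - 0)%R (g (L (RtoC t * W)))).
{ intros g Hg t Ht; rewrite Rminus_0_r in *; simpl in Ht.
  assert (HtW : (Cmod (RtoC t * W) <= 1)%R).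
  { rewrite Cmod_mult, Cmod_R.
    apply Rle_trans with (/ Cmod W * Cmod W)%R; [|right; field; lra].
    apply Rmult_le_compat_r; lra. }
  destruct (is_series_Re_Im _ _ (proj1 HL _ HtW)) as [H1 H2].
  assert (Hk : forall k, (RtoC t * W) ^ S k / RtoC (INR (S k)) ^ 2 =
    RtoC (t ^ S k / INR (S k) ^ 2) * W ^ S k).
  { intros k; rewrite Cpow_mult_l, RtoC_div, !RtoC_pow; [unfold Cdiv; ring|].
    apply pow_nonzero, not_0_INR; lia. }
  assert (H : is_series (fun k => g ((RtoC t * W) ^ S k / RtoC (INR (S k)) ^ 2))
    (g (L (RtoC t * W)))) by (destruct Hg as [->| ->]; assumption).
  apply is_series_decr_1.
  match goal with |- is_series _ ?l => replace l with (g (L (RtoC t * W))) end.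
  2:{ rewrite scal_pow_n; unfold plus, opp; simpl; ring. }
  apply is_series_ext with (2 := H); intros k; rewrite Hk.
  change (c g (S k)) with (g (W ^ S k)%C / INR (S k) ^ 2)%R.
  rewrite scal_pow_n; eq_at R.
  assert (INR (S k) <> 0)%R by (apply not_0_INR; lia).
  destruct Hg as [->| ->]; [rewrite re_scal_l | rewrite im_scal_l]; field; auto. }
assert (Hcr : forall g : C -> R, (g = Re \/ g = Im) -> Rbar_lt 0 (CV_radius (c g))).
{ intros g Hg; pose proof (cond_pos d).
  apply CV_radius_pos_of_ex with (d / 2)%R; [lra|].
  exists (g (L (RtoC (d / 2) * W))).
  pose proof (Hc g Hg (d / 2)%R) as H1; rewrite Rminus_0_r in H1; apply H1.
  rewrite Rabs_pos_eq; lra. }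
set (al := fun (g : C -> R) n => g (W ^ S n)).
assert (Hth : forall g : C -> R, (g = Re \/ g = Im) ->
  CV_radius (al g) = CV_radius (c g) /\
  locally 0%R (fun t => derive_t_derive (fun t => g (L (RtoC t * W))) t = PSeries (al g) t)).
{ intros g Hg; pose proof (Hcr g Hg) as Hr.
  (* Differentiating, multiplying by [t] and differentiating again cancels the weight [1 / (n+1)^2];
     what remains is the geometric series with coefficients [W^(n+1)]. *)
  assert (E : forall n, PS_derive (PS_incr_1 (PS_derive (c g))) n = al g n).
  { intros n.
    transitivity (INR (S n) * (INR (S n) * (g (W ^ S n)%C / INR (S n) ^ 2)))%R;
      [reflexivity | unfold al].
    field; apply not_0_INR; lia. }
  split.
  - now rewrite <- (CV_radius_ext _ _ E), CV_radius_derive, CV_radius_incr_1, CV_radius_derive.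
  - assert (H1 : locally 0%R (fun t => g (L (RtoC t * W)) = PSeries (c g) (t - 0))).
    { exists d; intros t Ht; symmetry; now apply is_pseries_unique, Hc. }
    apply PSeries_Derive_near in H1; [|exact Hr].
    assert (H2 : locally 0%R (fun t => (t * Derive (fun t => g (L (RtoC t * W)%C)) t)%R =
      PSeries (PS_incr_1 (PS_derive (c g))) (t - 0))).
    { revert H1; apply filter_imp; intros t Ht.
      rewrite PSeries_incr_1; rewrite Rminus_0_r in *.
      exact (f_equal (Rmult t) Ht). }
    apply PSeries_Derive_near in H2.
    + revert H2; apply filter_imp; intros t Ht; rewrite Rminus_0_r in Ht.
      rewrite <- (PSeries_ext _ _ _ E); exact Ht.
    + now rewrite CV_radius_incr_1, CV_radius_derive. }
destruct (Hth Re (or_introl eq_refl)) as [Er Hp].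
destruct (Hth Im (or_intror eq_refl)) as [Ei Hq].
assert (Rr : Rbar_lt 0 (CV_radius (al Re))) by (rewrite Er; apply Hcr; now left).
assert (Ri : Rbar_lt 0 (CV_radius (al Im))) by (rewrite Ei; apply Hcr; now right).
generalize (filter_and _ _ (filter_and _ _ Hp Hq)
  (filter_and _ _ (CV_radius_near _ 0 Rr) (CV_radius_near _ 0 Ri))).
apply filter_imp; intros t [[Ht1 Ht2] [Hr Hi]]; rewrite Rminus_0_r in *.
fold p in Ht1; fold q in Ht2.
apply CV_radius_inside in Hr; apply CV_radius_inside in Hi.
rewrite Ht1, Ht2.
(* Used to split [W^(n+2) = W W^(n+1)] into components: [b] is [- Im W] for the real part and [Im W]
   for the imaginary part. *)
assert (X : forall u v b, ex_pseries u t -> ex_pseries v t ->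
  PSeries (fun n => Re W * u n + b * v n)%R t = (Re W * PSeries u t + b * PSeries v t)%R).
{ intros u v b Hu Hv.
  rewrite <- !PSeries_scal, <- PSeries_plus; [reflexivity | |];
    apply ex_pseries_scal; auto; apply Rmult_comm. }
split.
- rewrite PSeries_decr_1 at 1 by exact Hr.
  replace (al Re 0%nat) with (Re W) by (unfold al; now rewrite Cpow_1_r).
  f_equal; f_equal.
  rewrite (PSeries_ext _ (fun n => Re W * al Re n + - Im W * al Im n)%R).
  + rewrite X by assumption; ring.
  + intros n; unfold PS_decr_1, al; rewrite (Cpow_S W (S n)), re_mult; ring.
- rewrite PSeries_decr_1 at 1 by exact Hi.
  replace (al Im 0%nat) with (Im W) by (unfold al; now rewrite Cpow_1_r).
  f_equal; f_equal.
  rewrite (PSeries_ext _ (fun n => Re W * al Im n + Im W * al Re n)%R).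
  + rewrite X by assumption; ring.
  + intros n; unfold PS_decr_1, al; rewrite (Cpow_S W (S n)), im_mult; ring.
Qed.

Lemma dilogarithm_0 (L : C -> C) : is_dilogarithm L -> L 0 = 0.
Proof.
intros [H _].
assert (H0 : (Cmod 0 <= 1)%R) by (rewrite Cmod_0; lra).
destruct (is_series_Re_Im _ _ (H 0 H0)) as [H1 H2].
assert (Hk : forall k, 0 ^ S k / RtoC (INR (S k)) ^ 2 = RtoC 0)
  by (intros; simpl Cpow; unfold Cdiv; ring).
assert (K : forall u l, is_series u l -> (forall k, u k = 0%R) -> l = 0%R).
{ intros u l Hu Hu0.
  assert (Hl : is_lim_seq (sum_n u) l) by exact Hu.
  apply (is_lim_seq_ext _ (fun _ => 0%R)), is_lim_seq_unique in Hl.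
  - rewrite Lim_seq_const in Hl; now injection Hl.
  - induction n as [|n IH]; [now rewrite sum_O|].
    rewrite sum_Sn, IH, Hu0; apply Rplus_0_r. }
apply injective_projections.
- apply (K _ _ H1); intros; now rewrite Hk.
- apply (K _ _ H2); intros; now rewrite Hk.
Qed.

(** With [W = 1 / lam], the defining series covers only [t <= 1 / |W|], possibly short of 1. The
    equation [(1 - t W) (t L')' = W], with [L'] the derivative of [L (t W)] in [t], has analytic
    sides and therefore persists up to [t = 1]. *)
Lemma Clog_moment_simple_pole (L : C -> C) (lam : C) :
  is_dilogarithm L -> off_segment lam ->
  Clog_moment (fun x => / (RtoC x - lam)) (L (1 / lam)).
Proof.
intros HL Hlam.
pose proof (off_segment_neq_0 _ Hlam) as Hl0.
set (W := / lam).
assert (HW : W <> 0).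
{ intros E; apply C1_nz; rewrite <- (Cinv_r lam Hl0); fold W; rewrite E; ring. }
set (p := fun t : R => Re (L (RtoC t * W))).
set (q := fun t : R => Im (L (RtoC t * W))).
assert (Hpq : forall t, (0 <= t <= 1)%R -> real_analytic p t /\ real_analytic q t).
{ intros t Ht; apply analytic_at_ray; [exact HW|].
  apply (proj2 HL); now apply inv_off_segment. }
set (tp := fun t => (t * Derive p t)%R); set (tq := fun t => (t * Derive q t)%R).
assert (Hid : forall t0, real_analytic (fun t => t) t0).
{ intros t0; apply real_analytic_ext with (2 := real_analytic_affine 0 1 t0).
  intros t; ring. }
assert (Hcst : forall c t0, real_analytic (fun _ => c) t0).
{ intros c t0; apply real_analytic_ext with (2 := real_analytic_affine c 0 t0).
  intros t; ring. }
assert (Htpq : forall t, (0 <= t <= 1)%R -> real_analytic tp t /\ real_analytic tq t).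
{ intros t Ht; destruct (Hpq t Ht) as [H1 H2].
  split; apply real_analytic_mult; auto using real_analytic_Derive. }
set (a := Re W); set (b := Im W).
(* Each component is written as an expression equal to 0, with affine factors in the form
   [c + d * t], to match the closure lemmas and the identity theorem. *)
assert (Hode : forall t, (0 <= t <= 1)%R ->
  (- a + (1 + - a * t) * Derive tp t + (0 + b * t) * Derive tq t = 0 /\
   - b + (1 + - a * t) * Derive tq t + (0 + - b * t) * Derive tp t = 0)%R).
{ pose proof (dilog_ray_ode L W HL HW) as Hloc; cbv zeta in Hloc; fold p q a b in Hloc.
  change (derive_t_derive p) with (Derive tp) in Hloc;
    change (derive_t_derive q) with (Derive tq) in Hloc.
  intros t Ht; split; revert t Ht.
  - apply (real_analytic_identity (fun t => - a + (1 + - a * t) * Derive tp t +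
      (0 + b * t) * Derive tq t)%R 1 ltac:(lra)).
    + intros t Ht; destruct (Htpq t Ht) as [H1 H2].
      repeat apply real_analytic_plus; try apply real_analytic_mult;
        auto using real_analytic_affine, real_analytic_Derive.
    + revert Hloc; apply filter_imp; intros t [H1 H2]; lra.
  - apply (real_analytic_identity (fun t => - b + (1 + - a * t) * Derive tq t +
      (0 + - b * t) * Derive tp t)%R 1 ltac:(lra)).
    + intros t Ht; destruct (Htpq t Ht) as [H1 H2].
      repeat apply real_analytic_plus; try apply real_analytic_mult;
        auto using real_analytic_affine, real_analytic_Derive.
    + revert Hloc; apply filter_imp; intros t [H1 H2]; lra. }
set (P := fun t : R => - L (RtoC t * W)).
replace (L (1 / lam)) with (P 0%R - P 1%R).
2:{ unfold P; rewrite !Cmult_0_l, (dilogarithm_0 L HL), Cmult_1_l.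
    replace (1 / lam) with W by (unfold W, Cdiv; ring); ring. }
apply (Clog_moment_intro P (fun t => - (Derive p t, Derive q t))).
intros x Hx; destruct (Hpq x Hx) as [Hp Hq], (Htpq x Hx) as [Hp' Hq'].
pose proof (off_segment_neq _ _ Hlam Hx) as Hxl.
pose proof (locally_singleton _ _ (real_analytic_is_derive _ _ Hp)) as Dp.
pose proof (locally_singleton _ _ (real_analytic_is_derive _ _ Hq)) as Dq.
pose proof (locally_singleton _ _ (real_analytic_is_derive _ _ Hp')) as Dp'.
pose proof (locally_singleton _ _ (real_analytic_is_derive _ _ Hq')) as Dq'.
split.
- split; [exact (is_derive_opp (K := R_AbsRing) (V := R_NormedModule) _ _ _ Dp)
         | exact (is_derive_opp (K := R_AbsRing) (V := R_NormedModule) _ _ _ Dq)].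
- destruct (Hode x Hx) as [E1 E2].
  (* Solving the equation gives [- W / (1 - x W)], which is [1 / (x - lam)]. *)
  assert (E : / (RtoC x - lam) = - (Derive tp x, Derive tq x)).
  { assert (EW : (1 - RtoC x * W) * (Derive tp x, Derive tq x) = W).
    { apply injective_projections; unfold a, b, Re, Im in E1, E2.
      - transitivity ((1 - x * fst W) * Derive tp x + x * snd W * Derive tq x)%R;
          [simpl; ring | lra].
      - transitivity ((1 - x * fst W) * Derive tq x - x * snd W * Derive tp x)%R;
          [simpl; ring | lra]. }
    transitivity (- (/ (1 - RtoC x * W) * ((1 - RtoC x * W) * (Derive tp x, Derive tq x)))).
    - rewrite EW; unfold W; field; repeat split; try assumption.
      intros E'; apply Hxl.
      replace (RtoC x - lam) with (- (lam - RtoC x)) by ring; rewrite E'; ring.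
    - rewrite Cmult_assoc, Cinv_l; [ring|].
      (* If [1 - x W] vanished, the equation [EW] would give [W = 0]. *)
      intros E'; apply HW; rewrite <- EW, E'; ring. }
  rewrite E; split.
  + apply is_derive_ext with (fun y => - tp y)%R.
    { intros y; rewrite re_scal_l, re_opp; unfold tp; simpl; ring. }
    exact (is_derive_opp (K := R_AbsRing) (V := R_NormedModule) _ _ _ Dp').
  + apply is_derive_ext with (fun y => - tq y)%R.
    { intros y; rewrite im_scal_l, im_opp; unfold tq; simpl; ring. }
    exact (is_derive_opp (K := R_AbsRing) (V := R_NormedModule) _ _ _ Dq').
Qed.

(** * Assembly: the series as the moment of the partial fractions *)

Theorem theorem1 (Li2 : C -> C) (HLi2 : is_dilogarithm Li2)
  (m : nat) (z : R) (Hz : (1 <= Rabs z)%R) (z1 z2 z3 : C)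
  (Hdistinct : z1 <> z2 /\ z1 <> z3 /\ z2 <> z3)
  (H1 : z1 * (1 - z1) ^ 2 - RtoC z = 0)
  (H2 : z2 * (1 - z2) ^ 2 - RtoC z = 0)
  (H3 : z3 * (1 - z3) ^ 2 - RtoC z = 0) :
  let S (lam : C) : C :=
    sum_n_m (G := C_AbelianMonoid)
      (fun j => a_coef m z j lam * C_coef Li2 j lam) 0 m in
  ex_series (lhs_term m z) /\
  RtoC (Series (lhs_term m z)) = (-1) ^ m * (S z1 + S z2 + S z3).
Proof.
intros S.
assert (Hzu : forall x : R, (0 <= x <= 1)%R -> (z - x * (1 - x) ^ 2)%R <> 0%R).
{ intros x Hx E; pose proof (cubic_range x Hx) as Hu.
  replace z with (x * (1 - x) ^ 2)%R in Hz by lra.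
  rewrite Rabs_pos_eq in Hz by lra; lra. }
assert (Hoff : forall lam, lam * (1 - lam) ^ 2 - RtoC z = 0 -> off_segment lam).
{ intros lam Hlam x Hx <-; apply (Hzu x Hx), RtoC_inj.
  rewrite RtoC_minus, RtoC_mult, RtoC_pow, RtoC_minus.
  transitivity (- (RtoC x * (1 - RtoC x) ^ 2 - RtoC z)); [ring|].
  rewrite Hlam; ring. }
assert (Hpoles : forall lam, lam * (1 - lam) ^ 2 - RtoC z = 0 ->
  Clog_moment (fun x => polar_part (fun j => a_coef m z j lam) m lam (RtoC x)) (S lam)).
{ intros lam Hlam; apply Hoff in Hlam; unfold polar_part.
  apply (Clog_moment_csum (fun j x => a_coef m z j lam * / (RtoC x - lam) ^ Datatypes.S j)
    (fun j => a_coef m z j lam * C_coef Li2 j lam)).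
  intros [|j] _; apply Clog_moment_scal.
  - apply Clog_moment_ext with (2 := Clog_moment_simple_pole _ _ HLi2 Hlam).
    intros x _; now rewrite Cpow_1_r.
  - now apply Clog_moment_pole. }
(* The sign [(-1)^(m+1)] converts [(u - z)^(m+1)] into [(z - u)^(m+1)]; since the series sums to
   [- V], the statement has [(-1)^m]. *)
set (V := (-1) ^ Datatypes.S m * (S z1 + S z2 + S z3)).
assert (HV : Clog_moment (fun x => RtoC ((x * (1 - x) ^ 2) ^ m /
  (z - x * (1 - x) ^ 2) ^ Datatypes.S m)) V).
{ apply Clog_moment_ext with (fun x => (-1) ^ Datatypes.S m *
    (polar_part (fun j => a_coef m z j z1) m z1 (RtoC x) +
     polar_part (fun j => a_coef m z j z2) m z2 (RtoC x) +
     polar_part (fun j => a_coef m z j z3) m z3 (RtoC x))).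
  - intros x Hx.
    rewrite <- a_coef_partial_fractions; auto; try (now apply Hoff).
    assert (Hn : (z - x * (1 - x) ^ 2)%R <> 0%R) by now apply Hzu.
    rewrite RtoC_div by (now apply pow_nonzero).
    rewrite !RtoC_pow, RtoC_minus, RtoC_mult, !RtoC_pow, RtoC_minus.
    rewrite Cpow_mult_l, <- Cpow_mult_r.
    replace (RtoC x * (1 - RtoC x) ^ 2 - RtoC z) with
      ((-1) * (RtoC z - RtoC x * (1 - RtoC x) ^ 2)) by ring.
    rewrite (Cpow_mult_l (-1)).
    assert (Hc : (RtoC z - RtoC x * (1 - RtoC x) ^ 2) ^ Datatypes.S m <> 0).
    { apply Cpow_nz; intros E; apply Hn, RtoC_inj.
      now rewrite RtoC_minus, RtoC_mult, RtoC_pow, RtoC_minus. }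
    assert (Hm1 : (-1) ^ Datatypes.S m <> 0).
    { apply Cpow_nz; intros E; apply RtoC_inj in E; lra. }
    set (D := (RtoC z - RtoC x * (1 - RtoC x) ^ 2) ^ Datatypes.S m) in *.
    set (s := (-1) ^ Datatypes.S m) in *.
    field; split; assumption.
  - apply Clog_moment_scal, Clog_moment_plus; [apply Clog_moment_plus|]; now apply Hpoles. }
(* The three root sums are complex, but the integrand is real; hence so is [V]. *)
destruct (Clog_moment_real _ _ HV) as [HVr HVe].
pose proof (is_series_lhs_term m z _ Hz HVr) as Hser.
split; [eexists; exact Hser|].
rewrite (is_series_unique _ _ Hser), RtoC_opp, <- HVe.
unfold V; simpl Cpow; ring.
Qed.
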